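(* Let $p$ be a prime and $k$ a field of characteristic $p$. Let $a,r$ be positive integers, let $\lambda,\mu$ be partitions of $r$, and let $\alpha,\delta$ be partitions of $a$. Let $\mu$ have $p$-adic expansion $\mu=\sum_{i=0}^{s}\mu(i)p^i$. If $n>s$ is an integer, then $$[M^{\lambda+p^n\alpha}:Y^{\mu+p^n\delta}]\geq[M^\lambda:Y^\mu]\,[M^\alpha:Y^\delta].$$ Furthermore, if $p^n>\lambda_1$, then equality holds: $$[M^{\lambda+p^n\alpha}:Y^{\mu+p^n\delta}]=[M^\lambda:Y^\mu]\,[M^\alpha:Y^\delta].$$
   Context: $\mathcal{S}_r$ is the symmetric group on $r$ letters and all modules are (finite-dimensional, right) modules over the field $k$ of characteristic $p$. For a partition $\lambda$ of $r$, $M^\lambda$ is the Young permutation module: the permutation $k\mathcal{S}_r$-module with basis the set of all $\lambda$-tabloids, equivalently the permutation module on the cosets of the Young subgroup $\mathcal{S}_\lambda=\mathcal{S}_{\lambda_1}\times\mathcal{S}_{\lambda_2}\times\cdots$. The Specht module $S^\lambda$ is the submodule of $M^\lambda$ generated by a polytabloid. In any decomposition of $M^\lambda$ into indecomposable summands there is exactly one summand containing $S^\lambda$ as a submodule; it is well defined up to isomorphism and is called the Young module $Y^\lambda$. Every indecomposable direct summand of $M^\lambda$ is isomorphic to some $Y^\mu$ with $\mu$ a partition of $r$, and $Y^\lambda\cong Y^\mu$ only if $\lambda=\mu$. The $p$-Kostka number $[M^\lambda:Y^\mu]$ is the multiplicity of $Y^\mu$ as a summand in a decomposition of $M^\lambda$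 into indecomposable direct summands. Sums and multiples of partitions are taken part by part (allowing zero parts at the end): $(\lambda+\mu)_i=\lambda_i+\mu_i$ and $(a\lambda)_i=a\lambda_i$. A partition $\lambda$ is $p$-restricted if $\lambda_i-\lambda_{i+1}<p$ for all $i\ge 1$. Every partition $\lambda$ has a unique $p$-adic expansion $\lambda=\sum_{i\ge 0}\lambda(i)p^i$ with all $\lambda(i)$ being $p$-restricted partitions; writing $\mu=\sum_{i=0}^s\mu(i)p^i$ means $\mu(i)=\emptyset$ for $i>s$. *)

(* Defs.v *)
From mathcomp Require Import all_boot all_order all_algebra all_fingroup.
From mathcomp Require Import all_character.
From mathcomp Require Import boolp classical_sets.

Set Implicit Arguments.
Unset Strict Implicit.
Unset Printing Implicit Defensive.

Import GRing.Theory.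
Local Open Scope ring_scope.

(* A partition is the sequence of its nonzero parts; [nth 0 la i] is the part
   la_(i+1), zero beyond the end. *)
Definition is_part (la : seq nat) : bool := sorted geq la && (0%N \notin la).

Definition is_part_of (r : nat) (la : seq nat) : bool :=
  is_part la && (sumn la == r).

Definition addpart (la mu : seq nat) : seq nat :=
  mkseq (fun i => nth 0 la i + nth 0 mu i)%N (maxn (size la) (size mu)).

(* Only used for a > 0, so that no zero part is created. *)
Definition scalepart (a : nat) (la : seq nat) : seq nat :=
  [seq (a * x)%N | x <- la].

Definition p_restricted (p : nat) (la : seq nat) : Prop :=
  forall i : nat, (nth 0 la i - nth 0 la i.+1 < p)%N.

(* mu = \sum_(i <= s) mus i * p ^ i, the convention being that mus i is the
   empty partition for i > s. *)
Definition p_adic_expansion (p : nat) (mu : seq nat) (s : nat)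
    (mus : nat -> seq nat) : Prop :=
  [/\ forall i, is_part (mus i) /\ p_restricted p (mus i),
      forall i, (s < i)%N -> mus i = [::]
    & mu = \big[addpart/[::]]_(i < s.+1) scalepart (p ^ i) (mus i)].

(* The cells of the diagram of la are numbered 0, ..., r - 1 in reading order:
   cell c lies in row [reshape_index la c] and column [reshape_offset la c].
   A tableau is t : 'S_r, with entry t c in cell c.  Permutations compose from
   left to right, so 'S_r acts on tableaux by right multiplication, and
   t, t' are row equivalent iff t' = h * t for some h preserving the rows of
   cells.  Tabloids are thus exactly the right cosets of the Young subgroup. *)
Definition young_subgroup (r : nat) (la : seq nat) : {set 'S_r} :=
  [set h : 'S_r | [forall c, reshape_index la (h c) == reshape_index la c]].

Lemma young_subgroup_group_set r la : group_set (young_subgroup r la).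
Proof.
apply/group_setP; split=> [|g h]; first by rewrite inE; apply/forallP=> c; rewrite perm1.
rewrite !inE => /forallP gP /forallP hP; apply/forallP=> c.
by rewrite permM (eqP (hP _)) gP.
Qed.
Canonical young_subgroup_group r la := Group (young_subgroup_group_set r la).

(* The column stabiliser of the tableau 1. *)
Definition column_stabiliser (r : nat) (la : seq nat) : {set 'S_r} :=
  [set h : 'S_r | [forall c, reshape_offset la (h c) == reshape_offset la c]].

Definition tabloids (r : nat) (la : seq nat) : {set {set 'S_r}} :=
  rcosets (young_subgroup r la) [set: 'S_r].

(* Representations act on row vectors from the right, so a representation of G
   is a right module with basis the unit row vectors. *)
Definition young_perm_mx (k : fieldType) (r : nat) (la : seq nat) (g : 'S_r) :
    'M[k]_#|tabloids r la| :=
  \matrix_(i, j) ((enum_val i :* g)%g == enum_val j)%:R.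

Lemma young_perm_mx_repr (k : fieldType) (r : nat) (la : seq nat) :
  mx_repr [set: 'S_r] (@young_perm_mx k r la).
Proof.
split=> [|g h _ _]; apply/matrixP=> i j; rewrite !mxE.
  by rewrite rcoset1 (inj_eq enum_val_inj).
have xg_in : (enum_val i :* g)%g \in tabloids r la.
  have /rcosetsP[y _ ->] := enum_valP i.
  by apply/rcosetsP; exists (y * g)%g; rewrite ?inE // rcosetM.
rewrite (bigD1 (enum_rank_in xg_in (enum_val i :* g)%g)) //= !mxE.
rewrite enum_rankK_in // eqxx mul1r -rcosetM big1 ?addr0 // => l l_neq.
rewrite !mxE; case: eqP => [xgE|_]; last by rewrite mul0r.
by case/eqP: l_neq; apply: enum_val_inj; rewrite enum_rankK_in.
Qed.

(* M^la *)
Definition young_perm_module (k : fieldType) (r : nat) (la : seq nat) :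
    mx_representation k [set: 'S_r] #|tabloids r la| :=
  MxRepresentation (young_perm_mx_repr k r la).

(* The polytabloid \sum_h sgn(h) {1} h of the tableau 1, with h in its column
   stabiliser.  The polytabloid of a tableau t is its translate by t, so all
   polytabloids generate the same submodule. *)
Definition polytabloid (k : fieldType) (r : nat) (la : seq nat) :
    'rV[k]_#|tabloids r la| :=
  \row_j \sum_(h in column_stabiliser r la
               | (young_subgroup r la :* h)%g == enum_val j) (-1) ^+ h.

(* S^la *)
Definition specht (k : fieldType) (r : nat) (la : seq nat) :
    'M[k]_#|tabloids r la| :=
  cyclic_mx (young_perm_module k r la) (polytabloid k r la).

Section Decompositions.

Variables (k : fieldType) (gT : finGroupType) (G : {group gT}).

(* Submodules are given by matrices, through their row spaces. *)
Definition indecomposable n (rG : mx_representation k G n) (U : 'M[k]_n) :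
    Prop :=
  [/\ mxmodule rG U, U != 0
    & forall V W : 'M[k]_n, mxmodule rG V -> mxmodule rG W ->
        mxdirect (V + W)%MS -> (V + W :=: U)%MS -> V = 0 \/ W = 0].

Definition decomposition n (rG : mx_representation k G n) (D : seq 'M[k]_n) :
    Prop :=
  [/\ forall U, U \in D -> indecomposable rG U,
      mxdirect (\sum_(i < size D) D`_i)%MS
    & (\sum_(i < size D) D`_i :=: 1%:M)%MS].

Definition submod_isom n1 (rG1 : mx_representation k G n1) (U : 'M[k]_n1)
    n2 (rG2 : mx_representation k G n2) (V : 'M[k]_n2) : Prop :=
  exists (modU : mxmodule rG1 U) (modV : mxmodule rG2 V),
    mx_rsim (submod_repr modU) (submod_repr modV).

(* The multiplicity of the indecomposable module V in a chosen decomposition of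
   rG1.  One exists by induction on the dimension, and by the Krull-Schmidt
   theorem the multiplicity does not depend on the choice. *)
Definition multiplicity n1 (rG1 : mx_representation k G n1)
    n2 (rG2 : mx_representation k G n2) (V : 'M[k]_n2) : nat :=
  count (fun U => `[< submod_isom rG1 U rG2 V >])
        (xget [::] (decomposition rG1)).

End Decompositions.

(* Y^la, as a submodule of M^la: a chosen summand containing S^la in some
   decomposition of M^la; it is well defined up to isomorphism. *)
Definition young_module (k : fieldType) (r : nat) (la : seq nat) :
    'M[k]_#|tabloids r la| :=
  xget 0 (fun Y => exists D,
    [/\ decomposition (young_perm_module k r la) D,
        Y \in D
      & (specht k r la <= Y)%MS]).

(* The p-Kostka number [M^la : Y^mu], for la and mu partitions of r. *)
Definition p_kostka (k : fieldType) (r : nat) (la mu : seq nat) : nat :=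
  multiplicity (young_perm_module k r la)
               (young_perm_module k r mu) (young_module k r mu).

(* Main.v *)
Require Import Defs.
From mathcomp Require Import all_boot all_order all_algebra all_fingroup.
From mathcomp Require Import all_solvable all_character.
From mathcomp Require Import boolp mpoly zify.

Set Implicit Arguments.
Unset Strict Implicit.
Unset Printing Implicit Defensive.

(** Write [q] for [p ^ n] and [e] for the polytabloid of shape [mu].

    A Kostka number is a rank.  The signed column sum sends every tabloid of
    shape [mu] to a multiple of [e] (James), and it commutes with
    homomorphisms, so an endomorphism [th] of M^mu multiplies [e] by a scalar
    chi(th).  A composite through a summand U of M^la on which chi does not
    vanish restricts to an automorphism of Y^mu (Fitting), and then U is
    isomorphic to Y^mu.  Hence [M^la : Y^mu] is the rank of the
    pairing (f, g) |-> chi(f g) of Hom(M^mu, M^la) with Hom(M^la, M^mu)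
    ([count_summands_rank]).  By Frobenius reciprocity both spaces are the space
    of vectors of M^la fixed by the row stabiliser of [mu], spanned by orbit
    sums.  A tabloid of shape [la] is a word giving a colour to each cell of
    [mu]; its orbit is its type, the matrix A whose entry A(i, j) counts the
    cells of row i with colour j.  The pairing becomes a matrix of signed counts
    indexed by types ([p_kostka_form_rank]).

    The generating function of these counts, for all [la] at once, is
    D_mu(X Y^T), where D_mu(Z) is the product over the columns of [mu] of the
    leading principal minors of Z of the heights of the columns; the column
    sums of the exponents recover [la].  (The coefficients of D_mu(X Y^T) with
    respect to Y span the simple module L(mu) of the general linear group, and
    the rank is the dimension of its [la]-weight space.)  If Z = L U with L lower
    unitriangular and U upper triangular, then D_mu(Z) is the product of the
    U_ii ^ mu_i, which is multiplicative in [mu]; so D_(mu + q de) =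
    D_mu D_de ^ q generically, hence always ([diagram_det_shape_add]).  In
    characteristic p the Frobenius map turns D_de(X Y^T) ^ q into D_de taken
    at the q-th powers of the variables, and comparing coefficients
    expresses the form of [mu + q de] at (A, B) as the sum of the products of
    the forms of [mu] at (A1, B1) and of [de] at (A2, B2) over all
    A = A1 + q A2 and B = B1 + q B2 ([young_form_conv_pairs]).  This is the
    counterpart of the tensor product theorem of Steinberg.

    Since [s < n], all differences mu_i - mu_(i+1) are less than q.  Then the
    rank of the form of [mu] is already attained on the types with all entries
    less than q ([young_form_truncation]): in D_mu(X g Y^T), the coefficient
    of the monomial X ^ A0, the product of the antidiagonal terms of the
    minors, is up to sign D_mu(g Y^T), again by the lemma of James; but the
    exponents in A0 are differences mu_i - mu_(i+1), whereas (X g) ^ A is in the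
    ideal of the q-th powers of the variables as soon as an entry of A is at
    least q.  So each row of the form is a combination of rows indexed by
    truncated types.  For truncated A1 the sum A1 + q A2 determines A1 and A2,
    so the Kronecker product of the two forms, truncated on the first factor, is
    a submatrix of the form of [mu + q de]: this is the inequality.  If moreover
    [la_0 < q], the only way of writing the content [la + q al] as
    [la' + q al'] with [la'] of total [r] is the given one, so the form of
    [mu + q de] at that content factors through the Kronecker product, which
    is the opposite inequality. *)

(** * Homomorphisms of representations and the Fitting lemma *)

Section Homs.

Import GRing.Theory.
Local Open Scope ring_scope.

Variables (k : fieldType) (gT : finGroupType) (G : {group gT}).

Definition intertwines n1 n2 (r1 : mx_representation k G n1)
    (r2 : mx_representation k G n2) (f : 'M[k]_(n1, n2)) : Prop :=
  forall g, g \in G -> r1 g *m f = f *m r2 g.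

Lemma intertwinesM n1 n2 n3 (r1 : mx_representation k G n1)
    (r2 : mx_representation k G n2) (r3 : mx_representation k G n3) f g :
  intertwines r1 r2 f -> intertwines r2 r3 g -> intertwines r1 r3 (f *m g).
Proof. by move=> hf hg x xG; rewrite mulmxA hf // -!mulmxA hg. Qed.

Lemma intertwines1 n (rG : mx_representation k G n) : intertwines rG rG 1%:M.
Proof. by move=> x xG; rewrite mulmx1 mul1mx. Qed.

Lemma intertwinesX n (rG : mx_representation k G n.+1) f i :
  intertwines rG rG f -> intertwines rG rG (f ^+ i).
Proof.
move=> hf; elim: i => [|i IHi]; first exact: intertwines1.
by rewrite exprS; apply: (intertwinesM hf IHi).
Qed.

Lemma intertwines_module n1 n2 (r1 : mx_representation k G n1)
    (r2 : mx_representation k G n2) f m (U : 'M_(m, n1)) :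
  intertwines r1 r2 f -> mxmodule r1 U -> mxmodule r2 (U *m f).
Proof.
move=> hf mU; apply/mxmoduleP=> x xG; rewrite -mulmxA -hf // mulmxA.
by apply: submxMr; apply: (mxmoduleP mU).
Qed.

Lemma intertwines_kermx n1 n2 (r1 : mx_representation k G n1)
    (r2 : mx_representation k G n2) f :
  intertwines r1 r2 f -> mxmodule r1 (kermx f).
Proof.
move=> hf; apply/mxmoduleP=> x xG; apply/sub_kermxP.
by rewrite -mulmxA hf // mulmxA mulmx_ker mul0mx.
Qed.

(** Fitting: the image of a large power of [th] is a complement in [Y] of its
    kernel on [Y], and it is nonzero because it contains [e]. *)
Lemma indec_fitting n (rG : mx_representation k G n) (Y : 'M_n) (e : 'rV_n)
    (th : 'M_n) (c : k) :
  indecomposable rG Y -> intertwines rG rG th -> (th <= Y)%MS ->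
  e != 0 -> (e <= Y)%MS -> c != 0 -> e *m th = c *: e ->
  (Y :&: kermx th = 0)%MS /\ (Y *m th :=: Y)%MS.
Proof.
case: n rG Y e th => [|n] rG Y e th [mY nzY indY] hth thY nze eY nzc eth.
  by case/eqP: nze; apply/rowP; case.
have IthY (i : nat) m (W : 'M_(m, n.+1)) : (W <= Y)%MS -> (W *m th ^+ i <= Y)%MS.
  case: i => [|i] WY; first by rewrite expr0 mulmx1.
  by rewrite exprSr mulmxA (submx_trans (submxMl _ _)).
have decr i : (th ^+ i.+1 <= th ^+ i)%MS.
  by rewrite exprS -mulmxE submxMl.
(* The images decrease, so they are stationary from some power on. *)
have [j Hj] : exists j, (th ^+ j <= th ^+ j.+1)%MS.
  have [//|nex] := pselect (exists j, (th ^+ j <= th ^+ j.+1)%MS).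
  have rk i : (\rank (th ^+ i) + i <= n.+1)%N.
    elim: i => [|i IHi]; first by rewrite addn0 rank_leq_row.
    apply: leq_trans IHi; rewrite addnS ltn_add2r.
    by apply: rank_ltmx; rewrite /ltmx decr; apply/negP => H; apply: nex; exists i.
  by have := rk n.+2; rewrite leqNgt addnS ltnS leq_addl.
have stab1 l : (j <= l)%N -> (th ^+ l <= th ^+ l.+1)%MS.
  by move/subnKC=> <-; rewrite -addSn !exprD -!mulmxE submxMr.
have stab i l : (j <= l)%N -> (th ^+ l <= th ^+ (l + i))%MS.
  move=> jl; elim: i => [|i IHi]; first by rewrite addn0.
  apply: submx_trans IHi _; rewrite addnS; apply: stab1.
  exact: leq_trans jl (leq_addr _ _).
(* The exponent is positive so that the kernel of [T] contains that of [th]. *)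
pose T := th ^+ j.+1; have hT : intertwines rG rG T by apply: intertwinesX.
have stabT i : (T <= th ^+ (j.+1 + i))%MS by apply: stab.
have eT : e *m T = c ^+ j.+1 *: e.
  rewrite /T; elim: j.+1 => [|i IHi]; first by rewrite !expr0 mulmx1 scale1r.
  by rewrite exprSr -mulmxE mulmxA IHi -scalemxAl eth scalerA -exprSr.
have nzT : c ^+ j.+1 != 0 by rewrite expf_neq0.
have kerTT : (kermx (T *m T) <= kermx T)%MS.
  have sub : (kermx T <= kermx (T *m T))%MS.
    by apply/sub_kermxP; rewrite mulmxA mulmx_ker mul0mx.
  have := mxrank_leqif_sup sub; case=> _ <-; rewrite !mxrank_ker.
  apply/eqP; congr (_ - _)%N; apply/eqP; rewrite eqn_leq mxrankM_maxl andbT.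
  by rewrite mxrankS // mulmxE -exprD stabT.
have YT0 : (Y :&: kermx T)%MS = 0.
  have [] := indY (Y :&: kermx T)%MS (Y *m T) => //.
  - by apply: capmx_module => //; apply: intertwines_kermx hT.
  - by apply: intertwines_module hT _.
  - apply/mxdirect_addsP/eqP; rewrite -submx0; apply/rV_subP => v.
    rewrite !sub_capmx => /andP[/andP[_ vT] /submxP[y vE]].
    have : (y *m Y <= kermx (T *m T))%MS.
      by apply/sub_kermxP; rewrite mulmxA -(mulmxA y) -vE; apply/sub_kermxP.
    by move/submx_trans/(_ kerTT)/sub_kermxP; rewrite -mulmxA -vE => ->;
      apply: sub0mx.
  - apply/eqmxP; rewrite addsmx_sub capmxSl IthY //=.
    apply/rV_subP => y yY.
    have /submxP[z yT] : (y *m T <= th ^+ (j.+1 + j.+1).+1)%MS.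
      by rewrite -addnS; apply: submx_trans (stabT _); apply: submxMl.
    have zY : (z *m th <= Y)%MS by apply: submx_trans (submxMl _ _) thY.
    have zTT : y *m T = z *m th *m T *m T.
      by rewrite yT exprS exprD -!mulmxE !mulmxA.
    rewrite -[y](subrK (z *m th *m T)); apply: addmx_sub_adds; last exact: submxMr.
    rewrite sub_capmx; apply/andP; split.
      by rewrite addmx_sub // eqmx_opp; apply: (IthY j.+1).
    by apply/sub_kermxP; rewrite mulmxBl zTT subrr.
  move=> YT; have : (e *m T <= Y *m T)%MS by apply: submxMr.
  by rewrite eT YT submx0 scaler_eq0 (negPf nzT) (negPf nze).
have Yk : (Y :&: kermx th = 0)%MS.
  apply/eqP; rewrite -submx0 -YT0 capmxS //; apply/sub_kermxP.
  by rewrite /T exprS -mulmxE mulmxA mulmx_ker mul0mx.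
split=> //; apply/eqmxP; rewrite -(mxrank_leqif_eq _).
  by rewrite -(mxrank_mul_ker Y th) Yk mxrank0 addn0.
by apply: submx_trans (submxMl _ _) thY.
Qed.

End Homs.

(** * Decompositions into indecomposable summands *)

Section Decomp.

Import GRing.Theory.
Local Open Scope ring_scope.

Variables (k : fieldType) (gT : finGroupType) (G : {group gT}).

Lemma mxdirect_seqE n (D : seq 'M[k]_n) (W : 'M[k]_n) :
  (\sum_(U <- D) U :=: W)%MS -> (\sum_(U <- D) \rank U = \rank W)%N ->
  mxdirect (\sum_(i < size D) D`_i)%MS /\ (\sum_(i < size D) D`_i :=: W)%MS.
Proof.
have sE : (\sum_(U <- D) U = \sum_(i < size D) D`_i)%MS.
  by rewrite (big_nth 0) big_mkord.
rewrite sE => DW rkD; split=> //.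
by rewrite mxdirectE /= DW -rkD (big_nth 0) big_mkord.
Qed.

Lemma decomposition_of_module n (rG : mx_representation k G n) (W : 'M_n) :
  mxmodule rG W -> exists D : seq 'M[k]_n,
   [/\ forall U, U \in D -> indecomposable rG U,
       (\sum_(U <- D) U :=: W)%MS & (\sum_(U <- D) \rank U = \rank W)%N].
Proof.
elim/ltn_ind: {W}(\rank W) {-2}W (erefl (\rank W)) => d IHd W Wd modW.
have [->|nzW] := eqVneq W 0.
  by exists [::]; split=> //; rewrite big_nil // mxrank0.
have [indW|nindW] := pselect (indecomposable rG W).
  exists [:: W]; rewrite !big_seq1; split=> // U; first by rewrite inE => /eqP->.
have [U [V [modU modV dUV UVW nzUV]]] : exists U V : 'M[k]_n, [/\ mxmodule rG U,
    mxmodule rG V, mxdirect (U + V)%MS, (U + V :=: W)%MS & U <> 0 /\ V <> 0].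
  apply: contrapT => nex; apply: nindW; split=> // U V modU modV dUV UVW.
  have [U0|nzU] := pselect (U = 0); [by left | right].
  by apply: contrapT => nzV; apply: nex; exists U, V; split.
have rk : (\rank U + \rank V = d)%N.
  by rewrite -Wd -UVW; apply/esym/eqP; move: dUV; rewrite mxdirectE.
have [/eqP nzU /eqP nzV] := nzUV.
have Ud : (\rank U < d)%N by rewrite -rk -[ltnLHS]addn0 ltn_add2l lt0n mxrank_eq0.
have Vd : (\rank V < d)%N by rewrite -rk -[ltnLHS]add0n ltn_add2r lt0n mxrank_eq0.
have [DU [indU sU rU]] := IHd _ Ud U erefl modU.
have [DV [indV sV rV]] := IHd _ Vd V erefl modV.
exists (DU ++ DV); rewrite !big_cat /=; split.
- by move=> X; rewrite mem_cat => /orP[/indU|/indV].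
- by apply: eqmx_trans UVW; apply: adds_eqmx.
- by rewrite rU rV rk Wd.
Qed.

Lemma decomposition_exists n (rG : mx_representation k G n) :
  exists D, decomposition rG D.
Proof.
have [D [indD sD rD]] := decomposition_of_module (mxmodule1 rG).
have [dD DE] := mxdirect_seqE sD rD.
by exists D; split.
Qed.

(** The projections along the other summands, which are idempotent
    endomorphisms with sum 1. *)
Lemma decomposition_proj n (rG : mx_representation k G n) D :
  decomposition rG D -> exists pr : 'I_(size D) -> 'M[k]_n,
  [/\ forall i, intertwines rG rG (pr i), forall i : 'I_(size D), (pr i <= D`_i)%MS,
      forall (i : 'I_(size D)) m (W : 'M_(m, n)), (W <= D`_i)%MS -> W *m pr i = W,
      forall (i j : 'I_(size D)) m (W : 'M_(m, n)), i != j -> (W <= D`_i)%MS ->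
        W *m pr j = 0
    & \sum_i pr i = 1%:M].
Proof.
move=> [indD dxD DE].
have modD (i : 'I_(size D)) : mxmodule rG D`_i by case: (indD _ (mem_nth 0
  (ltn_ord i))).
pose W (i : 'I_(size D)) := (\sum_(j < size D | j != i) D`_j)%MS.
have dx (i : 'I_(size D)) : (D`_i :&: W i =
  0)%MS by move/mxdirect_sumsP: dxD => /(_ i isT).
have sW (i j : 'I_(size D)) : i != j -> (D`_i <= W j)%MS.
  by move=> ij; apply: (sumsmx_sup i).
pose pr (i : 'I_(size D)) := proj_mx D`_i (W i).
have pr1 (i : 'I_(size D)) m (X : 'M_(m, n)) : (X <= D`_i)%MS -> X *m pr i = X.
  exact: proj_mx_id.
have pr0 (i j : 'I_(size D)) m (X : 'M_(m, n)) : i != j -> (X <= D`_i)%MS ->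
  X *m pr j = 0.
  by move=> ij XD; apply: proj_mx_0 => //; apply: submx_trans XD (sW _ _ ij).
exists pr; split=> //.
- move=> i x xG; have sum1 : (1%:M <= D`_i + W i)%MS.
    by rewrite -DE; apply/sumsmx_subP => j _; have [->|/sW ji] := eqVneq j i;
      [apply: addsmxSl | apply: submx_trans ji (addsmxSr _ _)].
  have modW : mxmodule rG (W i) by apply: sumsmx_module.
  have /hom_mxP/(_ x xG) := submx_trans sum1 (proj_mx_hom (dx i) (modD i) modW).
  by rewrite !mul1mx.
- by move=> i; rewrite -[pr i]mul1mx proj_mx_sub.
have : (1%:M <= \sum_(i < size D) D`_i)%MS by rewrite DE.
case/sub_sumsmxP => u uE.
rewrite -[LHS]mul1mx {1}uE mulmx_suml [RHS]uE; apply: eq_bigr => i _.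
rewrite mulmx_sumr (bigD1 i) //= pr1 ?submxMl // big1 ?addr0 // => j ji.
by rewrite (@pr0 i) ?submxMl // eq_sym.
Qed.

(** An isomorphism between the images of two idempotents extends to the ambient
    modules, where its two halves compose to the idempotents themselves. *)
Lemma submod_isom_inv n1 (r1 : mx_representation k G n1) (U p1 : 'M[k]_n1)
    n2 (r2 : mx_representation k G n2) (V p2 : 'M[k]_n2) :
  intertwines r1 r1 p1 -> (p1 <= U)%MS -> U *m p1 = U ->
  intertwines r2 r2 p2 -> (p2 <= V)%MS -> V *m p2 = V ->
  submod_isom r1 U r2 V ->
  exists (a : 'M_(n2, n1)) (b : 'M_(n1, n2)), [/\ intertwines r2 r1 a,
    intertwines r1 r2 b,
    a *m b = p2, b *m a = p1 & a *m p1 = a /\ p1 *m b = b].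
Proof.
move=> h1 p1U Up1 h2 p2V Vp2 [modU [modV /mx_rsim_def[B [B' B'B BE]]]].
have BB' : B *m B' = 1%:M.
  by have := BE 1%g (group1 G); rewrite !repr_mx1 mulmx1 => <-.
have comB x : x \in G -> submod_repr modU x *m B = B *m submod_repr modV x.
  by move=> xG; rewrite BE // -mulmxA B'B mulmx1.
have comB' x : x \in G -> submod_repr modV x *m B' = B' *m submod_repr modU x.
  by move=> xG; rewrite (BE x xG) -[B *m _ *m B']mulmxA (mulmxA B') B'B mul1mx.
have mulVs n' m1 m2 (U0 : 'M[k]_n') (M : 'M_(m1, m2)) (W : 'M_(m2, \rank U0)) :
  M *m val_submod W = val_submod (M *m W) by exact: mulmxA.
have mulIs n' m1 m2 (U0 : 'M[k]_n') (M : 'M_(m1, m2)) (W : 'M_(m2, n')) :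
  M *m in_submod U0 W = in_submod U0 (M *m W) by exact: mulmxA.
have half n1' (r1' : mx_representation k G n1') (U' p1' : 'M[k]_n1')
    (modU' : mxmodule r1' U')
    n2' (r2' : mx_representation k G n2') (V' : 'M[k]_n2')
    (modV' : mxmodule r2' V') (C : 'M_(\rank U', \rank V')) :
    intertwines r1' r1' p1' -> (p1' <= U')%MS ->
    (forall x, x \in G ->
       submod_repr modU' x *m C = C *m submod_repr modV' x) ->
    intertwines r1' r2' (val_submod (in_submod U' p1' *m C)).
  move=> h p1'U' hC x xG.
  rewrite mulVs [in LHS]mulmxA mulIs h // (in_submodJ modU') // -mulmxA hC //.
  by rewrite mulmxA val_submodJ.
pose b := val_submod (in_submod U p1 *m B) : 'M_(n1, n2).
pose a := val_submod (in_submod V p2 *m B') : 'M_(n2, n1).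
have comp n1' n2' n3' (U1 p1' : 'M[k]_n1') (U2 p2' : 'M[k]_n2')
    (U3 : 'M[k]_n3') (C : 'M_(\rank U1, \rank U2))
    (C' : 'M_(\rank U2, \rank U3)) : U2 *m p2' = U2 ->
    val_submod (in_submod U1 p1' *m C) *m val_submod (in_submod U2 p2' *m C')
    = val_submod (in_submod U1 p1' *m (C *m C')).
  move=> Up; rewrite mulVs (mulmxA (val_submod _) (in_submod _ _) C') mulIs;
    congr (val_submod _).
  rewrite (mulmxA (in_submod _ _) C C'); congr (_ *m C').
  have /submxP[u uE] := val_submodP (in_submod U1 p1' *m C).
  by rewrite -[RHS]val_submodK; congr in_submod; rewrite uE -mulmxA Up.
have p1E : val_submod (in_submod U p1 *m 1%:M) = p1 by rewrite mulmx1 in_submodK.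
exists a, b; split.
- exact: half.
- exact: half.
- by rewrite comp // B'B mulmx1 in_submodK.
- by rewrite comp // BB' p1E.
- by rewrite -{1}p1E comp // mulmx1 -{1}p1E comp // mul1mx.
Qed.

End Decomp.

(** * Multiplicities as ranks *)

Section Mult.

Import GRing.Theory.
Local Open Scope ring_scope.

Variables (k : fieldType) (gT : finGroupType) (G : {group gT}).

Lemma submod_isom_eqmx n1 (r1 : mx_representation k G n1) (Y : 'M[k]_n1)
    n2 (r2 : mx_representation k G n2) (U : 'M[k]_n2) (a : 'M_(n1, n2)) :
  mxmodule r1 Y -> mxmodule r2 U -> intertwines r1 r2 a -> (Y :&: kermx a = 0)%MS ->
  (Y *m a :=: U)%MS -> submod_isom r2 U r1 Y.
Proof.
move=> modY modU ha Ya0 YaU; exists modU, modY; apply: mx_rsim_sym.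
have rkYa : \rank (Y *m a) = \rank Y.
  by rewrite -(mxrank_mul_ker Y a) Ya0 mxrank0 addn0.
pose VY := val_submod (1%:M : 'M_(\rank Y)).
have VYa : (VY *m a <= U)%MS by rewrite -YaU submxMr // val_submod1.
have mulVs (W : 'M_(\rank Y)) : val_submod W = W *m VY by rewrite val_submodE.
exists (in_submod U (VY *m a)); first by rewrite -rkYa YaU.
  rewrite /row_free eqn_leq rank_leq_row /=.
  have rkVYa : \rank Y = \rank (VY *m a).
    apply: etrans (esym rkYa) _; apply/eqmx_rank/eqmxP.
    by apply: eqmxMr; apply: eqmx_sym; apply: val_submod1.
  by apply: leq_trans (eq_leq rkVYa) _; rewrite -{1}(in_submodK VYa) mxrankM_maxl.
move=> x xG; rewrite -(in_submodJ modU) // -mulmxA -ha // [in RHS]mulmxA.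
rewrite -val_submodJ // mul1mx mulVs.
by rewrite in_submodE [RHS]in_submodE !mulmxA.
Qed.

(** If the scalar action on [e] factors through [U] without vanishing, then the
    composite [Y -> U -> Y] is bijective by Fitting; hence [Y] embeds as a
    direct summand of [U], and so is all of [U]. *)
Lemma submod_isom_of_factor n1 (r1 : mx_representation k G n1) (Y pY : 'M[k]_n1)
    n2 (r2 : mx_representation k G n2) (U pU : 'M[k]_n2) f g (e : 'rV_n1) c :
  indecomposable r1 Y -> intertwines r1 r1 pY -> (pY <= Y)%MS -> Y *m pY = Y ->
  indecomposable r2 U -> intertwines r2 r2 pU -> (pU <= U)%MS -> U *m pU = U ->
  intertwines r1 r2 f -> intertwines r2 r1 g -> (e <= Y)%MS -> e != 0 ->
  e *m f *m pU *m g = c *: e -> c != 0 -> submod_isom r2 U r1 Y.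
Proof.
move=> indY hpY pYY YpY indU hpU pUU UpU hf hg eY nze efg nzc.
have [[modY nzY _] [modU nzU inU]] := (indY, indU).
have epY : e *m pY = e by have /submxP[u ->] := eY; rewrite -mulmxA YpY.
pose a := pY *m f *m pU; pose b := g *m pY.
have ha : intertwines r1 r2 a by apply: (intertwinesM (intertwinesM hpY hf) hpU).
have hb : intertwines r2 r1 b by apply: (intertwinesM hg hpY).
have eab : e *m (a *m b) = c *: e by rewrite !mulmxA epY efg -scalemxAl epY.
have abY : (a *m b <= Y)%MS by rewrite mulmxA mulmx_sub.
have [kab Yab] := indec_fitting indY (intertwinesM ha hb) abY nze eY nzc eab.
have ka : (Y :&: kermx a = 0)%MS.
  apply/eqP; rewrite -submx0 -kab capmxS //.
  by apply/sub_kermxP; rewrite mulmxA mulmx_ker mul0mx.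
have YaU : (Y *m a <= U)%MS by rewrite /a !mulmx_sub.
have nzYa : Y *m a != 0.
  have := mxrank_mul_ker Y a; rewrite ka mxrank0 addn0.
  by rewrite -!mxrank_eq0 => ->; rewrite mxrank_eq0.
apply: (submod_isom_eqmx modY modU ha ka).
have modYa : mxmodule r2 <<Y *m a>>%MS.
  by rewrite (eqmx_module _ (genmxE _)); apply: (intertwines_module ha).
have modK : mxmodule r2 (U :&: kermx b)%MS.
  by apply: capmx_module => //; apply: intertwines_kermx hb.
have sumU : (<<Y *m a>> + (U :&: kermx b) :=: U)%MS.
  apply/eqmxP; rewrite addsmx_sub genmxE YaU capmxSl /=; apply/rV_subP => u uU.
  have : (u *m b <= Y *m a *m b)%MS by rewrite -mulmxA Yab mulmxA mulmx_sub.
  case/submxP=> y uy.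
  rewrite -[u](subrK (y *m Y *m a)) addrC.
  apply: addmx_sub_adds; first by rewrite genmxE -(mulmxA y) submxMl.
  rewrite sub_capmx; apply/andP; split.
    by rewrite addmx_sub // eqmx_opp -(mulmxA y) mulmx_sub.
  by apply/sub_kermxP; rewrite mulmxBl uy !mulmxA subrr.
have dx : mxdirect (<<Y *m a>> + (U :&: kermx b))%MS.
  apply/mxdirect_addsP/eqP; rewrite -submx0; apply/rV_subP => v.
  rewrite !sub_capmx genmxE => /and3P[/submxP[y vE] _ /sub_kermxP vb].
  have : (y *m Y <= Y :&: kermx (a *m b))%MS.
    by rewrite sub_capmx submxMl; apply/sub_kermxP; rewrite -vb vE !mulmxA.
  by rewrite kab submx0 => /eqP yY; rewrite vE mulmxA yY mul0mx sub0mx.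
have [Ya0|K0] := inU _ _ modYa modK dx sumU; first by case/eqP: nzYa;
  apply/eqP; rewrite -submx0 -genmxE Ya0.
apply: eqmx_trans sumU; rewrite K0; apply: eqmx_sym.
by apply: eqmx_trans (genmxE _); apply: addsmx0.
Qed.

Lemma mxrank_sum_le (I : finType) (P : pred I) m n (A : I -> 'M[k]_(m, n)) :
  (forall i, P i -> (\rank (A i) <= 1)%N) ->
  (\rank (\sum_(i | P i) A i)%R <= #|P|)%N.
Proof.
move=> A1; rewrite -sum1_card; elim/big_ind2: _ => // [|? ? ? ? h1 h2].
  by rewrite mxrank0.
exact: leq_trans (mxrank_add _ _) (leq_add h1 h2).
Qed.

Lemma mulmx_row_col m n p (A : 'M[k]_(m, n)) (B : 'M_(n, p)) i j :
  (A *m B) i j = (row i A *m col j B) 0 0.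
Proof. by rewrite !mxE; apply: eq_bigr => x _; rewrite !mxE. Qed.

Lemma mulmx_col0 m n p (A : 'M[k]_(m, n)) (B : 'M_(n, p)) i j :
  (A *m col j B) i 0 = (A *m B) i j.
Proof. by rewrite !mxE; apply: eq_bigr => x _; rewrite !mxE. Qed.

(** The rank of the pairing (f, g) |-> chi(f g).  Since [e 0 j0 = 1], the scalar
    chi(f g) is the entry [j0] of [e f g], that is, an entry of the product of
    [P], whose rows span the vectors [e f], and [Q], whose columns span the columns
    [j0] of the [g].  Inserting the projections of [rG] splits the product into
    one term for each summand, equal to 0 unless the summand is isomorphic to
    [Y] and of rank 1 if it is; the isomorphisms with [Y] exhibit an identity
    matrix of the expected size. *)
Lemma count_summands_rank n (rG : mx_representation k G n) m
    (rH : mx_representation k G m) (e : 'rV_m) (j0 : 'I_m) (Y : 'M_m) DY D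
    s t (P : 'M_(s, n)) (Q : 'M_(n, t)) :
  decomposition rH DY -> Y \in DY -> (e <= Y)%MS -> e 0 j0 = 1 ->
  (forall th, intertwines rH rH th -> exists c, e *m th = c *: e) ->
  (forall i, exists2 f, intertwines rH rG f & row i P = e *m f) ->
  (forall f, intertwines rH rG f -> (e *m f <= P)%MS) ->
  (forall j, exists2 g, intertwines rG rH g & col j Q = col j0 g) ->
  (forall g, intertwines rG rH g -> exists u, col j0 g = Q *m u) ->
  decomposition rG D ->
  count (fun U => `[< submod_isom rG U rH Y >]) D = \rank (P *m Q).
Proof.
move=> decY YD eY ej0 scal Prow Psub Qcol Qsub decD.
have nze : e != 0.
  by apply: contra_eq_neq ej0 => ->; rewrite mxE eq_sym oner_eq0.
have [indY dxY _] := decY; have iY := indY _ YD.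
have [prY [hprY prYY prY1 _ _]] := decomposition_proj decY.
have [jY ltY YE] := nthP 0 YD.
pose pY := prY (Ordinal ltY).
have hpY : intertwines rH rH pY by apply: hprY.
have pYY : (pY <= Y)%MS by have := prYY (Ordinal ltY); rewrite /= YE.
have YpY : Y *m pY = Y by apply: prY1; rewrite /= YE.
have epY : e *m pY = e by have /submxP[u ->] := eY; rewrite -mulmxA YpY.
have [pr [hpr prD pr1 pr0 prsum]] := decomposition_proj decD.
have [indD _ _] := decD.
have indDi (i : 'I_(size D)) : indecomposable rG D`_i by apply/indD/mem_nth.
pose S := [pred i : 'I_(size D) | `[< submod_isom rG D`_i rH Y >]].
have -> : count (fun U => `[< submod_isom rG U rH Y >]) D = #|S|.
  by rewrite -sum1_count (big_nth 0) big_mkord sum1_card.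
have entry A i j f g : row i P = e *m f -> col j Q = col j0 g ->
    (P *m A *m Q) i j = (e *m f *m A *m g) 0 j0.
  by move=> Pi Qj; rewrite mulmx_row_col row_mul Pi Qj mulmx_col0.
have comp : forall i, exists w : ('M_(m, n) * 'M_(n, m)) * ('rV_s * 'cV_t),
   S i -> [/\ [/\ intertwines rH rG w.1.1, intertwines rG rH w.1.2,
     w.1.1 *m w.1.2 = pY,
     w.1.2 *m w.1.1 = pr i & w.1.1 *m pr i = w.1.1 /\ pr i *m w.1.2 = w.1.2],
     e *m w.1.1 = w.2.1 *m P & col j0 w.1.2 = Q *m w.2.2].
  move=> i; have [/asboolP iso|nS] := boolP (S i); last first.
    by exists ((0, 0), (0, 0)).
  have [a [b [ha hb ab ba pab]]] := submod_isom_inv (hpr i) (prD i)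
     (pr1 i _ _ (submx_refl _)) hpY pYY YpY iso.
  have [/submxP[l le] [u ue]] := (Psub _ ha, Qsub _ hb).
  by exists ((a, b), (l, u)).
have {comp}[w wP] := choice comp.
apply/eqP; rewrite eqn_leq; apply/andP; split.
  pose L := \matrix_(i < #|S|) (w (enum_val i)).2.1.
  pose R := \matrix_(j < t, i < #|S|) (w (enum_val i)).2.2 j 0.
  have LR : L *m (P *m Q) *m R = 1%:M.
    apply/matrixP=> i j; rewrite [in RHS]mxE.
    have [[_ _ ab _ [ap _]] el _] := wP _ (enum_valP i).
    have [[_ _ _ _ [_ pb]] _ er] := wP _ (enum_valP j).
    transitivity ((e *m (w (enum_val i)).1.1 *m (w (enum_val j)).1.2) 0 j0).
      rewrite mulmx_row_col row_mul.
      have -> : row i L = (w (enum_val i)).2.1 by apply/rowP => x; rewrite !mxE.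
      have -> : col j R = (w (enum_val j)).2.2 by apply/colP => x; rewrite !mxE.
      by rewrite mulmxA -mulmxA -el -er mulmx_col0.
    have [->|ij] := eqVneq i j.
      by rewrite -mulmxA; have [[_ _ -> _ _] _ _] := wP _ (enum_valP j);
        rewrite epY.
    rewrite -ap -pb -!mulmxA (mulmxA (pr _)) [pr _ *m pr _](_ : _ = 0).
      by rewrite mul0mx !mulmx0 mxE.
    by rewrite (pr0 (enum_val i)) // (inj_eq enum_val_inj).
  have := mxrankM_maxl (L *m (P *m Q)) R; rewrite LR mxrank1 => h.
  exact: leq_trans h (mxrankM_maxr _ _).
have PQ : P *m Q = \sum_(i | S i) P *m pr i *m Q.
  rewrite -[P in LHS]mulmx1 -prsum mulmx_sumr mulmx_suml.
  rewrite (bigID S) /= [X in _ + X]big1 ?addr0 // => i nS.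
  apply/matrixP => x y; have [f hf Pf] := Prow x; have [g hg Qg] := Qcol y.
  rewrite (entry _ _ _ _ _ Pf Qg) [RHS]mxE.
  have [c efg] := scal _ (intertwinesM (intertwinesM hf (hpr i)) hg).
  rewrite -!mulmxA in efg *; rewrite efg mxE ej0 mulr1.
  apply: contraNeq nS => nzc; apply/asboolP.
  apply: (submod_isom_of_factor iY hpY pYY YpY (indDi i) (hpr i) (prD i) _ hf
    hg eY nze _ nzc).
    exact: pr1.
  by rewrite -!mulmxA.
rewrite PQ; apply: mxrank_sum_le => i Si.
have [[ha hb _ ba _] _ _] := wP i Si.
have -> : P *m pr i = col j0 (P *m (w i).1.2) *m (e *m (w i).1.1).
  rewrite -ba !mulmxA; congr (_ *m _).
  apply/row_matrixP => x; rewrite row_mul; have [f hf Pf] := Prow x.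
  have [c cE] := scal _ (intertwinesM hf hb).
  rewrite Pf row_mul -mulmxA cE; apply/rowP => y.
  rewrite !mxE big_ord1 !mxE; congr (_ * _).
  transitivity ((row x P *m (w i).1.2) 0 j0); last by rewrite -row_mul !mxE.
  by rewrite Pf -mulmxA cE mxE ej0 mulr1.
rewrite -!mulmxA; apply: leq_trans (mxrankM_maxl _ _) _.
by rewrite rank_leq_col.
Qed.

End Mult.

(** * Cells of a diagram and the lemma of James *)

Section Cells.

Variables (r : nat) (mu : seq nat).
Hypothesis hmu : is_part_of r mu.

Definition crow (la : seq nat) (c : 'I_r) : nat := reshape_index la c.
Definition ccol (la : seq nat) (c : 'I_r) : nat := reshape_offset la c.
(** The argument [c0] is only a default, for pairs that are not cells. *)
Definition cellat (la : seq nat) (c0 : 'I_r) (i j : nat) : 'I_r :=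
  odflt c0 [pick c | (crow la c == i) && (ccol la c == j)].

Lemma sumn_part : sumn mu = r.
Proof. by case/andP: hmu => _ /eqP. Qed.

Lemma part_noninc i j : i <= j -> nth 0 mu j <= nth 0 mu i.
Proof.
case/andP: hmu => /andP[srt _] _ ij.
have [js|js] := ltnP j (size mu); last by rewrite nth_default.
have tr : transitive geq by move=> a b c ab bc; apply: leq_trans bc ab.
apply: (sorted_leq_nth tr leqnn 0 srt) => //.
exact: leq_ltn_trans ij js.
Qed.

Lemma crow_lt c : crow mu c < size mu.
Proof. by apply: reshape_indexP; rewrite sumn_part. Qed.

Lemma ccol_lt c : ccol mu c < nth 0 mu (crow mu c).
Proof. by apply: reshape_offsetP; rewrite sumn_part. Qed.

Lemma cell_eq c d : crow mu c = crow mu d -> ccol mu c = ccol mu d -> c = d.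
Proof.
move=> e1 e2; apply: val_inj; rewrite /= -(reshape_indexK mu c).
by rewrite -(reshape_indexK mu d) -/(crow mu c) e1 -/(ccol mu c) e2.
Qed.

Lemma cell_ex i j : j < nth 0 mu i -> exists c, crow mu c = i /\ ccol mu c = j.
Proof.
move=> ji; have lt : flatten_index mu i j < r.
  by rewrite -sumn_part; apply: flatten_indexP.
by exists (Ordinal lt); split; [apply: flatten_indexKl | apply: flatten_indexKr].
Qed.

Lemma cellatP c0 i j : j < nth 0 mu i ->
  crow mu (cellat mu c0 i j) = i /\ ccol mu (cellat mu c0 i j) = j.
Proof.
move=> ji; rewrite /cellat; case: pickP => [c /andP[/eqP-> /eqP->] //|].
by have [c [<- <-]] := cell_ex ji => /(_ c); rewrite !eqxx.
Qed.

Lemma card_crow i : #|[set c | crow mu c == i]| = nth 0 mu i.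
Proof.
have lt (j : 'I_(nth 0 mu i)) : flatten_index mu i j < r.
  by rewrite -sumn_part; apply: flatten_indexP.
rewrite -[RHS]card_ord -(@card_imset _ _ (fun j => Ordinal (lt j))); last first.
  move=> j j' /(congr1 val) /= e; apply: val_inj => /=.
  by rewrite -(@flatten_indexKr mu i j) ?e ?flatten_indexKr.
apply: eq_card => c; rewrite inE; apply/eqP/imsetP => [ci|[j _ ->]].
  have cj := ccol_lt c; rewrite ci in cj; exists (Ordinal cj) => //.
  by apply: val_inj; rewrite /= -ci reshape_indexK.
exact: flatten_indexKl.
Qed.

Lemma inj_card_surj (T T' : finType) (f : T -> T') (A : {set T}) (B : {set T'}) y :
  {in A &, injective f} -> {in A, forall x, f x \in B} -> #|A| = #|B| ->
  y \in B -> exists2 x, x \in A & y = f x.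
Proof.
move=> injf fAB AB yB; suff /imsetP : y \in f @: A by [].
suff -> : f @: A = B by [].
apply/eqP; rewrite eqEcard card_in_imset // AB leqnn andbT.
by apply/subsetP => z /imsetP[x xA ->]; apply: fAB.
Qed.

(** The combinatorial part of the lemma of James.  If the colours of the cells of
    each column are distinct and there are mu_i cells of each colour i, then the
    colours of a column of height m are 0, ..., m - 1: by induction on i, the
    smaller colours already fill the columns too short to have a row i, so
    that the mu_i cells of colour i lie in the mu_i other columns. *)
Lemma column_injective_word (w : 'I_r -> nat) :
  (forall i, #|[set c | w c == i]| = nth 0 mu i) ->
  (forall c d, w c = w d -> ccol mu c = ccol mu d -> c = d) ->
  exists2 h, h \in column_stabiliser r mu & forall c, w c = crow mu (h c).
Proof.
move=> wmu winj.
have surj i j : (forall c, w c = i -> ccol mu c < nth 0 mu i) ->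
    j < nth 0 mu i -> exists c, w c = i /\ ccol mu c = j.
  move=> wi ji; have [d [di dj]] := cell_ex ji.
  pose f c := cellat mu d i (ccol mu c).
  have fP c : w c = i -> crow mu (f c) = i /\ ccol mu (f c) = ccol mu c.
    by move=> /wi ci; apply: cellatP.
  have [||||c] := @inj_card_surj _ _ f [set c | w c == i]
    [set c | crow mu c == i] d.
  - move=> c c'; rewrite !inE => /eqP ci /eqP ci' ff; apply: winj.
      by rewrite ci ci'.
    by have [_ <-] := fP _ ci; have [_ <-] := fP _ ci'; rewrite ff.
  - by move=> c; rewrite !inE => /eqP /fP[-> _].
  - by rewrite wmu card_crow.
  - by rewrite inE di.
  rewrite inE => /eqP ci dE; exists c; split=> //.
  by have [_ <-] := fP _ ci; rewrite -dE.
have wcol i : forall c, w c = i -> ccol mu c < nth 0 mu i.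
  elim/ltn_ind: i => i IHi c ci; rewrite ltnNge; apply/negP => ji.
  pose A := [set d | ccol mu d == ccol mu c].
  have Ai d : d \in A -> crow mu d < i.
    rewrite inE => /eqP dc; rewrite ltnNge; apply/negP => /part_noninc le.
    by have := ccol_lt d; rewrite dc ltnNge (leq_trans le ji).
  pose f d := odflt d [pick d' | (w d' == crow mu d) && (d' \in A)].
  have fP d : d \in A -> w (f d) = crow mu d /\ f d \in A.
    move=> dA; rewrite /f; case: pickP => [d' /andP[/eqP-> ->] //|].
    have [d' [wd' cd']] := surj _ _ (IHi _ (Ai d dA)) (ccol_lt d).
    have d'A : d' \in A by move: dA; rewrite !inE cd'.
    by move/(_ d'); rewrite wd' eqxx d'A.
  have [||||d dA cE] := @inj_card_surj _ _ f A A c.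
  - move=> d d' dA dA' ff; apply: cell_eq.
      by have [<- _] := fP _ dA; have [<- _] := fP _ dA'; rewrite ff.
    by move: dA dA'; rewrite !inE => /eqP-> /eqP->.
  - by move=> d /fP[].
  - by [].
  - by rewrite inE.
  by have := Ai d dA; have [<- _] := fP d dA; rewrite -cE ci ltnn.
pose h0 c := cellat mu c (w c) (ccol mu c).
have h0P c : crow mu (h0 c) = w c /\ ccol mu (h0 c) = ccol mu c.
  by apply: cellatP; apply: wcol.
have h0_inj : injective h0.
  move=> c d e; apply: winj.
    by have [<- _] := h0P c; have [<- _] := h0P d; rewrite e.
  by have [_ <-] := h0P c; have [_ <-] := h0P d; rewrite e.
exists (perm h0_inj) => [|c]; last by rewrite permE; case: (h0P c).
by rewrite inE; apply/forallP => c; rewrite permE; case: (h0P c) => _ /eqP.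
Qed.

End Cells.

(** * Words and their types *)

(** Two families with the same multiset of values differ by a permutation of
    the indices. *)
Lemma fiber_perm (T : eqType) r (u v : 'I_r -> T) :
  (forall x, #|[set c | u c == x]| = #|[set c | v c == x]|) ->
  exists s : 'S_r, forall c, u c = v (s c).
Proof.
have cntE (f : 'I_r -> T) x : count_mem x [tuple f i | i < r] =
  #|[set c | f c == x]|.
  rewrite /= count_map enumT cardE [in RHS]/enum_mem size_filter.
  by apply: eq_count => c; rewrite /= inE.
move=> uv; have : perm_eq [tuple u i | i < r] [tuple v i | i < r].
  by apply/allP => x _; apply/eqP; rewrite !cntE uv.
case/tuple_permP => s sE; exists s => c.
have /= := congr1 (fun t : seq T => nth (u c) t c) sE.
by rewrite -!(tnth_nth (u c) [tuple _ | _ < r]) !tnth_mktuple.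
Qed.

Section Words.

Variables (N r : nat).
Implicit Types (u v w : {ffun 'I_r -> 'I_N.+1}) (h : 'S_r).

(** Composition with [h] is a left action, as permutations compose from left to
    right. *)
Definition wact w h : {ffun 'I_r -> 'I_N.+1} := [ffun c => w (h c)].
(** Colours are taken in ['I_N.+1] for a common bound [N], so that words of
    different contents and shapes can be compared. *)
Definition row_word (la : seq nat) : {ffun 'I_r -> 'I_N.+1} :=
  [ffun c => inord (crow la c)].
(** With [u] the rows of the cells, this is the type of the word [v]; general
    [u] are needed to let the column stabiliser act on rows instead of words. *)
Definition jcount u v : {ffun 'I_N.+1 * 'I_N.+1 -> nat} :=
  [ffun x => #|[set c | (u c, v c) == x]|].
Definition content w : {ffun 'I_N.+1 -> nat} := [ffun j => #|[set c | w c == j]|].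

Lemma wactM w h g : wact w (h * g)%g = wact (wact w g) h.
Proof. by apply/ffunP => c; rewrite !ffunE permM. Qed.

Lemma wact1 w : wact w 1%g = w.
Proof. by apply/ffunP => c; rewrite !ffunE perm1. Qed.

Lemma card_preim_perm (P : pred 'I_r) h : #|[set c | P (h c)]| = #|[set c | P c]|.
Proof.
rewrite -(card_imset _ (@perm_inj _ h)); apply: eq_card => c; rewrite inE.
apply/imsetP/idP => [[d]|Pc]; first by rewrite inE => Pd ->.
by exists (h^-1%g c); rewrite ?inE permKV.
Qed.

Lemma jcount_wact u v h : jcount (wact u h) (wact v h) = jcount u v.
Proof.
apply/ffunP => x; rewrite !ffunE.
rewrite -[RHS](card_preim_perm (fun c => (u c, v c) == x) h).
by apply: eq_card => c; rewrite !inE !ffunE.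
Qed.

Lemma content_wact w h : content (wact w h) = content w.
Proof.
apply/ffunP => x; rewrite !ffunE -[RHS](card_preim_perm (fun c => w c == x) h).
by apply: eq_card => c; rewrite !inE !ffunE.
Qed.

Lemma jcount_wactl u v h : jcount (wact u h) v = jcount u (wact v h^-1%g).
Proof. by rewrite -[RHS](jcount_wact _ _ h) -wactM mulgV wact1. Qed.

(** Types separate the orbits of words under the row stabiliser. *)
Lemma same_jcount_perm u v w : jcount u v = jcount u w ->
  exists h, wact u h = u /\ v = wact w h.
Proof.
move=> e; have [x|s sE] := @fiber_perm _ _ (fun c => (u c, v c)) (fun c =>
  (u c, w c)).
  by have /ffunP/(_ x) := e; rewrite !ffunE.
by exists s; split; apply/ffunP => c; rewrite !ffunE; case: (sE c).
Qed.

Lemma same_content_perm v w : content v = content w -> exists h, v = wact w h.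
Proof.
move=> e; have [x|s sE] := @fiber_perm _ _ v w.
  by have /ffunP/(_ x) := e; rewrite !ffunE.
by exists s; apply/ffunP => c; rewrite !ffunE sE.
Qed.

End Words.

Lemma size_part r la : is_part_of r la -> (size la <= r)%N.
Proof.
case/andP=> /andP[_ n0] /eqP <-; elim: la n0 => //= x la IHla.
by rewrite inE negb_or => /andP[x0 /IHla]; case: x x0 => // x _ h;
  rewrite addSn ltnS (leq_trans h) ?leq_addl.
Qed.

Section Types.

Variables (I : finType) (b : nat).

(** Types with entries at most [b] form a finite type, which can index
    matrices. *)
Definition type_val (A : {ffun I -> 'I_b.+1}) : {ffun I -> nat} :=
  [ffun x => val (A x)].
Definition type_of (f : {ffun I -> nat}) : {ffun I -> 'I_b.+1} :=
  [ffun x => inord (f x)].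

Lemma type_ofK (f : {ffun I -> nat}) : (forall x, f x <= b)%N ->
  type_val (type_of f) = f.
Proof. by move=> fb; apply/ffunP => x; rewrite !ffunE /= inordK // ltnS. Qed.

Lemma type_val_inj : injective type_val.
Proof.
by move=> A B /ffunP e; apply/ffunP => x; have := e x; rewrite !ffunE => /val_inj.
Qed.

End Types.

Section SignedSum.
Import GRing.Theory.
Local Open Scope ring_scope.

(** Pairing [h] with [t * h] cancels the terms.  The even and odd terms are
    compared, rather than the sum with its opposite, because 2 may be 0. *)
Lemma signed_sum_eq0 (R : pzRingType) r (C : {set 'S_r}) (t : 'S_r)
    (F : 'S_r -> R) :
  odd_perm t -> (forall h, (t * h \in C)%g = (h \in C)) ->
  (forall h, h \in C -> F (t * h)%g = F h) -> \sum_(h in C) (-1) ^+ h * F h = 0.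
Proof.
move=> ot Ct Ft; rewrite (bigID (@odd_perm _)) /=.
rewrite (reindex_inj (mulgI t)) /= -[X in X + _]opprK -sumrN addrC.
apply/eqP; rewrite subr_eq0; apply/eqP; apply: eq_big => [h|h /andP[hC nh]].
  by rewrite Ct odd_permM ot.
by rewrite Ft // odd_permM ot (negPf nh) expr0 expr1 !mul1r mulN1r opprK.
Qed.

End SignedSum.

(** * Tabloids as words *)

Section Tabloids.

Import GRing.Theory.
Local Open Scope ring_scope.

Variables (k : fieldType) (N r : nat) (la : seq nat).
Hypotheses (hla : is_part_of r la) (rN : (r <= N)%N).

Lemma row_wordE c : val (row_word N r la c) = crow la c.
Proof.
rewrite ffunE /= inordK // (leq_trans (crow_lt hla c)) //.
by apply: leq_trans (size_part hla) (leq_trans rN _).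
Qed.

Lemma in_young h : (h \in young_subgroup r la) =
  (wact (row_word N r la) h == row_word N r la).
Proof.
rewrite inE; apply/forallP/eqP => [hY|/ffunP hY]; last move=> c.
  by apply/ffunP => d; apply: val_inj; rewrite ffunE !row_wordE; apply/eqP/hY.
by have := congr1 val (hY c); rewrite ffunE !row_wordE => /eqP.
Qed.

(** The entry [x] of a tableau [t] lies in the cell [t^-1 x].  The word of a
    tabloid does not depend on the representative since changing it permutes
    cells within rows. *)
Definition tabloid_word (x : {set 'S_r}) := wact (row_word N r la) (repr x)^-1%g.

Lemma tabloid_word_rcoset t : tabloid_word (young_subgroup r la :* t)%g =
  wact (row_word N r la) t^-1%g.
Proof.
rewrite /tabloid_word; have /rcosetP[y yY ->] : (repr (young_subgroup r la :* t) \in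
  young_subgroup r la :* t)%g by apply: mem_repr (rcoset_refl _ _).
by rewrite invMg wactM; congr wact; apply/eqP; rewrite -in_young groupV.
Qed.

Lemma tabloidsP x :
  reflect (exists t, x = (young_subgroup r la :* t)%g) (x \in tabloids r la).
Proof.
apply: (iffP rcosetsP) => [[t _ ->]|[t ->]]; first by exists t.
by exists t; rewrite ?inE.
Qed.

Lemma rcoset_tabloid x g : x \in tabloids r la -> (x :* g)%g \in tabloids r la.
Proof.
by case/tabloidsP => t ->; apply/tabloidsP; exists (t * g)%g; rewrite rcosetM.
Qed.

Lemma tabloid_word_act x g : x \in tabloids r la ->
  tabloid_word (x :* g)%g = wact (tabloid_word x) g^-1%g.
Proof.
by case/tabloidsP => t ->; rewrite -rcosetM !tabloid_word_rcoset invMg wactM.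
Qed.

Lemma tabloid_word_inj : {in tabloids r la &, injective tabloid_word}.
Proof.
move=> x y /tabloidsP[t ->] /tabloidsP[s ->]; rewrite !tabloid_word_rcoset => e.
apply/esym/rcoset_eqP; rewrite mem_rcoset in_young wactM e -wactM.
by rewrite mulgV wact1.
Qed.

Lemma content_tabloid_word x : content (tabloid_word x) = content (row_word N r la).
Proof. exact: content_wact. Qed.

Lemma tabloid_word_surj w : content w = content (row_word N r la) ->
  exists2 x, x \in tabloids r la & tabloid_word x = w.
Proof.
case/same_content_perm => h ->; exists (young_subgroup r la :* h^-1)%g.
  by apply/tabloidsP; exists h^-1%g.
by rewrite tabloid_word_rcoset invgK.
Qed.

Lemma sum_tabloid_word (F : {ffun 'I_r -> 'I_N.+1} -> k) :
  \sum_(x in tabloids r la) F (tabloid_word x) =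
    \sum_(w | content w == content (row_word N r la)) F w.
Proof.
rewrite -(big_imset _ tabloid_word_inj); apply: eq_bigl => w /=.
apply/imsetP/eqP => [[x _ ->]|/tabloid_word_surj[x xT <-]];
  first exact: content_tabloid_word.
by exists x.
Qed.

Lemma young_perm_mxE (g : 'S_r) i j :
  young_perm_mx k la g i j = ((enum_val i :* g)%g == enum_val j)%:R.
Proof. by rewrite mxE. Qed.

Lemma young_perm_mx_tr (g : 'S_r) :
  (@young_perm_mx k r la g)^T = young_perm_mx k la g^-1%g.
Proof.
apply/matrixP => i j; rewrite mxE !young_perm_mxE; congr ((nat_of_bool _)%:R).
by apply/eqP/eqP => <-; rewrite -rcosetM ?mulgV ?mulVg rcoset1.
Qed.

Lemma row_young_perm (v : 'rV[k]_#|tabloids r la|) (g : 'S_r) i j :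
  (enum_val i :* g)%g = enum_val j -> (v *m young_perm_mx k la g) 0 j = v 0 i.
Proof.
move=> ij; rewrite mxE (bigD1 i) //= young_perm_mxE ij eqxx mulr1.
rewrite big1 ?addr0 // => l li; rewrite young_perm_mxE -ij.
by rewrite (inj_eq (can_inj (rcosetK g))) (inj_eq enum_val_inj) (negPf li) mulr0.
Qed.

Lemma base_tabloid_ex :
  exists j0 : 'I_#|tabloids r la|, enum_val j0 = young_subgroup r la.
Proof.
have yT : (young_subgroup r la : {set _}) \in tabloids r la.
  by apply/tabloidsP; exists 1%g; rewrite rcoset1.
by exists (enum_rank_in yT (young_subgroup r la)); rewrite enum_rankK_in.
Qed.

End Tabloids.

(** * The pairing on fixed vectors *)

Lemma column_group r mu : group_set (column_stabiliser r mu).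
Proof.
apply/group_setP; split=> [|g h].
  by rewrite inE; apply/forallP => c; rewrite perm1.
rewrite !inE => /forallP gC /forallP hC; apply/forallP => c.
by rewrite permM (eqP (hC _)) gC.
Qed.
Canonical column_stabiliser_group r mu := Group (column_group r mu).

Lemma mem_column r mu (h : 'S_r) :
  reflect (forall c, ccol mu (h c) = ccol mu c) (h \in column_stabiliser r mu).
Proof.
by rewrite inE; apply: (iffP forallP) => H c; apply/eqP; apply: H.
Qed.

Lemma tperm_column r mu (c d : 'I_r) :
  ccol mu c = ccol mu d -> tperm c d \in column_stabiliser r mu.
Proof. by move=> cd; apply/mem_column => x; case: tpermP => [->|->|]. Qed.

Section Kostka.

Import GRing.Theory.
Local Open Scope ring_scope.

Variables (k : fieldType) (N b r : nat) (la mu : seq nat).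
Hypotheses (hla : is_part_of r la) (hmu : is_part_of r mu).
Hypotheses (rN : (r <= N)%N) (rb : (r <= b)%N).

Local Notation Y := (young_subgroup r mu).
Local Notation C := (column_stabiliser r mu).

Definition column_sum (nu : seq nat) : 'M[k]_#|tabloids r nu| :=
  \sum_(h in C) (-1) ^+ h *: young_perm_mx k nu h.

Lemma row_column_sum nu i j : column_sum nu i j =
  \sum_(h in C) (-1) ^+ h * ((enum_val i :* h)%g == enum_val j)%:R.
Proof.
by rewrite summxE; apply: eq_bigr => h _; rewrite mxE young_perm_mxE.
Qed.

Lemma polytabloidE (j0 : 'I_#|tabloids r mu|) : enum_val j0 = Y ->
  polytabloid k r mu = row j0 (column_sum mu).
Proof.
move=> j0E; apply/rowP => j; rewrite !mxE row_column_sum j0E big_mkcondr /=.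
by apply: eq_bigr => h _; case: eqP => _; rewrite ?mulr1 ?mulr0.
Qed.

Lemma young_column_trivial h : h \in Y -> h \in C -> h = 1%g.
Proof.
rewrite inE => /forallP hY /mem_column hC; apply/permP => c; rewrite perm1.
by apply: (@cell_eq _ mu); [apply/eqP/hY | apply: hC].
Qed.

Lemma polytabloid_base (j0 : 'I_#|tabloids r mu|) : enum_val j0 = Y ->
  polytabloid k r mu 0 j0 = 1.
Proof.
move=> j0E; rewrite (polytabloidE j0E) mxE row_column_sum j0E.
rewrite (bigD1 1%g) ?group1 //= rcoset1 eqxx odd_perm1 expr0 mulr1 big1 ?addr0
  // => h.
case/andP => hC h1; case: eqP => [hE|_]; last by rewrite mulr0.
by case/eqP: h1; apply: young_column_trivial => //; rewrite -hE rcoset_refl.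
Qed.

(** The lemma of James: a tabloid with two entries of a column of [mu] in
    the same row is killed by a transposition; any other is the base tabloid moved
    by a column permutation. *)
Lemma row_column_sum_scalar i :
  exists c, row i (column_sum mu) = c *: polytabloid k r mu.
Proof.
have [j0 j0E] := base_tabloid_ex r mu.
have /tabloidsP[t xE] := enum_valP i.
have [winj|nwinj] := pselect (forall c d, crow mu (t^-1%g c) = crow mu (t^-1%g d) ->
    ccol mu c = ccol mu d -> c = d).
  have [j|h hC hE] := @column_injective_word r mu hmu (fun c =>
    crow mu (t^-1%g c)) _ winj.
    by rewrite (card_preim_perm (fun c => crow mu c == j)) (card_crow hmu).
  have {}xE : enum_val i = (Y :* h^-1)%g.
    rewrite xE; apply/rcoset_eqP; rewrite mem_rcoset invgK inE; apply/forallP => c.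
    by rewrite permM; apply/eqP; rewrite -[LHS]hE permK.
  exists ((-1) ^+ h); apply/rowP => j.
  rewrite (polytabloidE j0E) !mxE !row_column_sum xE j0E.
  rewrite (reindex_inj (mulgI h)) /= mulr_sumr; apply: eq_big => g.
    by rewrite groupMl.
  by move=> _; rewrite odd_permM signr_addb -rcosetM mulKg mulrA.
have [c [d [cd wcd ccd]]] : exists c d, [/\ c <> d,
   crow mu (t^-1%g c) = crow mu (t^-1%g d) & ccol mu c = ccol mu d].
  apply: contrapT => nex; apply: nwinj => c d wcd ccd.
  by apply: contrapT => cd; apply: nex; exists c, d; split.
exists 0; rewrite scale0r; apply/rowP => j; rewrite mxE row_column_sum mxE.
apply: (@signed_sum_eq0 _ _ _ (tperm c d)).
- by rewrite odd_tperm; apply/eqP.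
- by move=> h; rewrite groupMl // tperm_column.
move=> h _; congr ((nat_of_bool (_ == _))%:R); rewrite xE -!rcosetM.
apply/esym/rcoset_eqP; rewrite mem_rcoset !invMg !mulgA mulgK inE.
apply/forallP => e; rewrite !permM; apply/eqP.
rewrite tpermV -/(crow mu _) -/(crow mu e) -[in RHS](permK t e).
by case: tpermP => [->|->|].
Qed.

Lemma intertwines_column_sum n1 n2 f :
  intertwines (young_perm_module k r n1) (young_perm_module k r n2) f ->
  column_sum n1 *m f = f *m column_sum n2.
Proof.
move=> hf; rewrite mulmx_suml mulmx_sumr; apply: eq_bigr => h _.
by rewrite -scalemxAl -scalemxAr; congr (_ *: _); apply: hf; rewrite inE.
Qed.

Lemma polytabloid_scalar th :
  intertwines (young_perm_module k r mu) (young_perm_module k r mu) th ->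
  exists c, polytabloid k r mu *m th = c *: polytabloid k r mu.
Proof.
move=> hth; have [j0 j0E] := base_tabloid_ex r mu.
have [c cE] := choice row_column_sum_scalar.
exists (\sum_i th j0 i * c i).
rewrite {1}(polytabloidE j0E) -row_mul intertwines_column_sum // row_mul
  mulmx_sum_row.
rewrite scaler_suml; apply: eq_bigr => i _.
by rewrite cE scalerA mxE.
Qed.

(** The polytabloid is an eigenvector of each projection, and the eigenvalues
    add up to 1; so it lies in a summand, and the choice made in [young_module]
    is over a nonempty set. *)
Lemma young_module_summand : exists2 D,
  decomposition (young_perm_module k r mu) D &
  young_module k r mu \in D /\ (polytabloid k r mu <= young_module k r mu)%MS.
Proof.
set e := polytabloid k r mu.
have [D decD] := decomposition_exists (young_perm_module k r mu).
have [j0 j0E] := base_tabloid_ex r mu; have ej0 := polytabloid_base j0E.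
have [pr [hpr prD _ _ prsum]] := decomposition_proj decD.
have [c cE] := choice (fun i => polytabloid_scalar (hpr i)).
have [i nzc] : exists i, c i != 0.
  apply: contrapT => nex; have : e *m (\sum_i pr i) = 0.
    rewrite mulmx_sumr big1 // => i _; rewrite cE.
    have [->|nz] := eqVneq (c i) 0; first by rewrite scale0r.
    by case: nex; exists i.
  by rewrite prsum mulmx1 => e0; move/eqP: ej0; rewrite -/e e0 mxE eq_sym oner_eq0.
have : exists U, exists D, [/\ decomposition (young_perm_module k r mu) D, U \in D &
    (specht k r mu <= U)%MS].
  exists D`_i, D; split=> //; first exact: mem_nth.
  have [indD _ _] := decD; have [modU _ _] := indD _ (mem_nth 0 (ltn_ord i)).
  apply: cyclic_mx_sub => //; rewrite -[polytabloid _ _ _](scalerK nzc) -cE.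
  by rewrite scalemx_sub // (submx_trans (submxMl _ _)).
case/(classical_sets.xgetPex 0) => D' [decD' YD' SY]; exists D' => //; split=> //.
exact: submx_trans (cyclic_mx_id _ _) SY.
Qed.

(** A type that is not the type of a tabloid contributes a zero row, which does
    not change the ranks. *)
Definition orbit_sums :
    'M[k]_(#|{: {ffun 'I_N.+1 * 'I_N.+1 -> 'I_b.+1}}|, #|tabloids r la|) :=
  \matrix_(i, x) (jcount (row_word N r mu) (tabloid_word N la (enum_val x)) ==
    type_val (enum_val i))%:R.

Lemma jcount_le (u v : {ffun 'I_r -> 'I_N.+1}) x : (jcount u v x <= b)%N.
Proof.
rewrite ffunE (leq_trans _ rb) // -[leqRHS](card_ord r); exact: max_card.
Qed.

Definition fixed_vec (v : 'rV[k]_#|tabloids r la|) :=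
  forall h, h \in Y -> v *m young_perm_module k r la h = v.

Lemma fixed_orbit_sums i : fixed_vec (row i orbit_sums).
Proof.
move=> h hY; apply/rowP => j.
have yT : (enum_val j :* h^-1)%g \in tabloids r la by
  apply/rcoset_tabloid/enum_valP.
rewrite (row_young_perm _ (i := enum_rank_in yT (enum_val j :* h^-1)%g));
  last first.
  by rewrite enum_rankK_in // rcosetKV.
rewrite !mxE enum_rankK_in // (tabloid_word_act hla rN) ?enum_valP // invgK.
by move: hY; rewrite (in_young hmu rN) => /eqP {1}<-; rewrite jcount_wact.
Qed.

Lemma orbit_sums_span v : fixed_vec v -> (v <= orbit_sums)%MS.
Proof.
move=> hv.
have vE x y : jcount (row_word N r mu) (tabloid_word N la (enum_val x)) =
    jcount (row_word N r mu) (tabloid_word N la (enum_val y)) -> v 0 x = v 0 y.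
  case/same_jcount_perm => h [hY xy].
  have {}hY : (h^-1)%g \in Y by rewrite groupV (in_young hmu rN) hY.
  rewrite -[in LHS](hv _ hY) (row_young_perm _ (i := y)) //.
  apply: (tabloid_word_inj hla rN); rewrite ?rcoset_tabloid ?enum_valP //.
  by rewrite (tabloid_word_act hla rN) ?enum_valP // invgK.
pose ty (x : 'I_#|tabloids r la|) :=
  jcount (row_word N r mu) (tabloid_word N la (enum_val x)).
pose u := \row_(i < #|{: {ffun 'I_N.+1 * 'I_N.+1 -> 'I_b.+1}}|)
  (if [pick x | ty x == type_val (enum_val i)] is Some x then v 0 x else 0).
suff -> : v = u *m orbit_sums by apply: submxMl.
apply/rowP => x; rewrite mxE (bigD1 (enum_rank (type_of b (ty x)))) //=.
rewrite !mxE enum_rankK type_ofK; last by move=> y; apply: jcount_le.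
rewrite eqxx mulr1 [X in _ + X]big1 ?addr0 => [|A nA].
  by case: pickP => [y /eqP yx|/(_ x)]; [rewrite (vE x y) | rewrite eqxx].
rewrite !mxE; case: eqP => [xA|_]; last by rewrite mulr0.
case/eqP: nA; apply: enum_val_inj; rewrite enum_rankK; apply: type_val_inj.
by rewrite type_ofK // => y; apply: jcount_le.
Qed.

(** Frobenius reciprocity: M^mu is induced from the trivial module of the row
    stabiliser, so the image of the base tabloid can be any fixed vector. *)
Lemma intertwines_of_fixed (j0 : 'I_#|tabloids r mu|) v : enum_val j0 = Y ->
  fixed_vec v ->
  exists2 f, intertwines (young_perm_module k r mu) (young_perm_module k r la) f
    & row j0 f = v.
Proof.
move=> j0E hv.
have hrep t : v *m young_perm_module k r la (repr (Y :* t)%g) =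
  v *m young_perm_module k r la t.
  have /rcosetP[y yY ->] : (repr (Y :* t) \in Y :* t)%g by apply: mem_repr
    (rcoset_refl _ _).
  by rewrite repr_mxM ?inE // mulmxA (hv y).
exists (\matrix_i (v *m young_perm_module k r la (repr (enum_val i)))); last first.
  rewrite rowK j0E; have := hrep 1%g; rewrite rcoset1 => ->.
  by rewrite repr_mx1 mulmx1.
move=> g gG; apply/row_matrixP => i; rewrite !row_mul rowK.
have xT : (enum_val i :* g)%g \in tabloids r mu by apply/rcoset_tabloid/enum_valP.
set j := enum_rank_in xT (enum_val i :* g)%g.
have -> : row i (young_perm_module k r mu g) = delta_mx 0 j.
  apply/rowP => l; rewrite mxE [LHS]young_perm_mxE mxE eqxx /= -(inj_eq
    enum_val_inj).
  by rewrite enum_rankK_in // eq_sym.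
rewrite -rowE rowK enum_rankK_in //.
have /tabloidsP[t ->] := enum_valP i.
by rewrite -rcosetM !hrep repr_mxM ?inE // mulmxA.
Qed.

(** Tabloids are an orthonormal basis of an invariant form, so that transposition
    reverses homomorphisms. *)
Lemma intertwines_tr n1 n2 f :
  intertwines (young_perm_module k r n1) (young_perm_module k r n2) f ->
  intertwines (young_perm_module k r n2) (young_perm_module k r n1) f^T.
Proof.
move=> hf g gG; have := congr1 trmx (hf g^-1%g (groupVr gG)).
by rewrite !trmx_mul /= !young_perm_mx_tr invgK => ->.
Qed.

Lemma row_base_fixed (j0 : 'I_#|tabloids r mu|) f : enum_val j0 = Y ->
  intertwines (young_perm_module k r mu) (young_perm_module k r la) f ->
    fixed_vec (row j0 f).
Proof.
move=> j0E hf h hY; rewrite -row_mul -hf ?inE // row_mul.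
suff -> : row j0 (young_perm_module k r mu h) = delta_mx 0 j0 by rewrite -rowE.
apply/rowP => l; rewrite mxE [LHS]young_perm_mxE mxE eqxx /= j0E rcoset_id //.
by rewrite -(inj_eq enum_val_inj) j0E eq_sym.
Qed.

Lemma p_kostka_rank_orbit :
  p_kostka k r la mu = \rank (orbit_sums *m column_sum la *m orbit_sums^T).
Proof.
have [D0 decD0 [YD0 eY]] := young_module_summand.
have [j0 j0E] := base_tabloid_ex r mu.
have decD : decomposition (young_perm_module k r la)
    (classical_sets.xget [::] (decomposition (young_perm_module k r la))).
  exact: classical_sets.xgetPex (decomposition_exists _).
have eE := polytabloidE j0E.
apply: (count_summands_rank decD0 YD0 eY (polytabloid_base j0E)
  polytabloid_scalar) decD.
- move=> i; have [f hf fi] := intertwines_of_fixed j0E (@fixed_orbit_sums i).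
  by exists f => //; rewrite row_mul -fi -!row_mul eE -row_mul
    intertwines_column_sum.
- move=> f hf; rewrite eE -row_mul intertwines_column_sum // row_mul submxMr //.
  by apply: orbit_sums_span; apply: row_base_fixed.
- move=> j; have [f hf fi] := intertwines_of_fixed j0E (@fixed_orbit_sums j).
  by exists f^T; [apply: intertwines_tr | rewrite -tr_row -[col _ _]tr_row fi].
move=> g hg; have := orbit_sums_span (row_base_fixed j0E (intertwines_tr hg)).
case/submxP => u uE; exists u^T.
by rewrite -[LHS]trmxK tr_col uE trmx_mul.
Qed.

End Kostka.

(** * Ranks of forms indexed by finite types *)

Section Gamma.

Import GRing.Theory.
Local Open Scope ring_scope.

Variable (k : fieldType).

Definition form_rank (T : finType) (f : T -> T -> k) : nat :=
  \rank (\matrix_(i < #|T|, j < #|T|) f (enum_val i) (enum_val j)).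

Lemma form_rank_le (T J : finType) (f : T -> T -> k)
    (u : T -> J -> k) (v : J -> T -> k) :
  (forall x y, f x y = \sum_j u x j * v j y) -> (form_rank f <= #|J|)%N.
Proof.
move=> fE; pose U := \matrix_(i < #|T|, j < #|J|) u (enum_val i) (enum_val j).
pose V := \matrix_(j < #|J|, i < #|T|) v (enum_val j) (enum_val i).
rewrite /form_rank (_ : (\matrix_(i, j) _)%R = U *m V).
  exact: leq_trans (mxrankM_maxl _ _) (rank_leq_col _).
apply/matrixP => i j; rewrite !mxE fE (reindex _ (onW_bij _ (@enum_val_bij J))) /=.
by apply: eq_bigr => l _; rewrite !mxE.
Qed.

Lemma form_rank_ge (T J : finType) (f : T -> T -> k)
    (u : J -> T -> k) (v : T -> J -> k) :
  (forall i j, \sum_x \sum_y u i x * f x y * v y j = (i == j)%:R) ->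
    (#|J| <= form_rank f)%N.
Proof.
move=> fE; pose U := \matrix_(j < #|J|, i < #|T|) u (enum_val j) (enum_val i).
pose V := \matrix_(i < #|T|, j < #|J|) v (enum_val i) (enum_val j).
pose F := \matrix_(i < #|T|, j < #|T|) f (enum_val i) (enum_val j).
have : U *m F *m V = 1%:M.
  apply/matrixP => i j; rewrite !mxE -(inj_eq enum_val_inj) -fE exchange_big /=.
  rewrite [RHS](reindex _ (onW_bij _ (@enum_val_bij T))) /=; apply: eq_bigr => l _.
  rewrite !mxE big_distrl [RHS](reindex _ (onW_bij _ (@enum_val_bij T))) /=.
  by apply: eq_bigr => l' _; rewrite !mxE.
move/(congr1 (fun A : 'M_#|J| => \rank A)); rewrite mxrank1 => <-.
by apply: leq_trans (mxrankM_maxl _ _) (mxrankM_maxr _ _).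
Qed.

Lemma form_rank_factor (T : finType) (f : T -> T -> k) :
  exists (u : T -> 'I_(form_rank f) -> k) (v : 'I_(form_rank f) -> T -> k),
  forall x y, f x y = \sum_j u x j * v j y.
Proof.
set F := \matrix_(i < #|T|, j < #|T|) f (enum_val i) (enum_val j).
exists (fun x j => col_base F (enum_rank x) j), (fun j y =>
  row_base F j (enum_rank y)).
move=> x y; transitivity (F (enum_rank x) (enum_rank y));
  first by rewrite mxE !enum_rankK.
by rewrite -{1}(mulmx_base F) mxE.
Qed.

Lemma form_rank_inverse (T : finType) (f : T -> T -> k) :
  exists (u : 'I_(form_rank f) -> T -> k) (v : T -> 'I_(form_rank f) -> k),
  forall i j, \sum_x \sum_y u i x * f x y * v y j = (i == j)%:R.
Proof.
set F := \matrix_(i < #|T|, j < #|T|) f (enum_val i) (enum_val j).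
have /row_fullP[L LE] : row_full (col_base F) by apply: col_base_full.
have /row_freeP[R RE] : row_free (row_base F) by apply: row_base_free.
exists (fun i x => L i (enum_rank x)), (fun y j => R (enum_rank y) j) => i j.
have : L *m (col_base F *m row_base F) *m R = 1%:M by rewrite mulmxA LE mul1mx RE.
rewrite mulmx_base => /matrixP/(_ i j); rewrite [RHS]mxE => <-.
rewrite mxE exchange_big /= (reindex _ (onW_bij _ (@enum_val_bij T))) /=.
apply: eq_bigr => l _; rewrite mxE big_distrl.
rewrite (reindex _ (onW_bij _ (@enum_val_bij T))) /=.
by apply: eq_bigr => l' _; rewrite !mxE !enum_valK.
Qed.

(** Stated for arbitrary rectangular [a] and [b]; with matrices of zeros and ones
    it compares a form with one indexed by other types. *)
Lemma form_rank_mul (T J : finType) (f : T -> T -> k) (g : J -> J -> k)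
  (a : T -> J -> k) (b : J -> T -> k) :
  (forall x y, f x y = \sum_i \sum_j a x i * g i j * b j y) ->
    (form_rank f <= form_rank g)%N.
Proof.
move=> fE; have [u [v gE]] := form_rank_factor g.
rewrite -[form_rank g]card_ord;
  apply: (@form_rank_le _ _ f (fun x l => \sum_i a x i * u i l)
  (fun l y => \sum_j v l j * b j y)) => x y.
rewrite fE; under eq_bigr do under eq_bigr do rewrite gE mulr_sumr mulr_suml.
under eq_bigr do rewrite exchange_big /=.
rewrite exchange_big /=; apply: eq_bigr => l _; rewrite mulr_suml.
by apply: eq_bigr => i _; rewrite mulr_sumr; apply: eq_bigr => j _; rewrite !mulrA.
Qed.

Lemma form_rank_tensor (T J : finType) (f : T -> T -> k) (g : J -> J -> k) :
  form_rank (fun x y : T * J => f x.1 y.1 * g x.2 y.2) =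
    (form_rank f * form_rank g)%N.
Proof.
apply/eqP; rewrite eqn_leq; apply/andP; split.
  have [u [v fE]] := form_rank_factor f; have [u' [v' gE]] := form_rank_factor g.
  rewrite -[form_rank f]card_ord -[form_rank g]card_ord -card_prod.
  apply: (@form_rank_le _ _ _ (fun x l => u x.1 l.1 * u' x.2 l.2) (fun l y =>
    v l.1 y.1 * v' l.2 y.2)) => x y.
  rewrite fE gE big_distrlr pair_big /=.
  by apply: eq_bigr => l _; rewrite mulrACA.
have [u [v fE]] := form_rank_inverse f; have [u' [v' gE]] := form_rank_inverse g.
rewrite -[form_rank f]card_ord -[form_rank g]card_ord -card_prod.
apply: (@form_rank_ge _ _ _ (fun l x => u l.1 x.1 * u' l.2 x.2) (fun y l =>
  v y.1 l.1 * v' y.2 l.2)) => i j.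
transitivity ((i.1 == j.1)%:R * (i.2 == j.2)%:R : k); last by rewrite -natrM mulnb.
apply: esym; rewrite -fE -gE big_distrlr [LHS]pair_big /=; apply: eq_bigr => x _.
rewrite big_distrlr [LHS]pair_big /=; apply: eq_bigr => y _.
by rewrite mulrACA; congr (_ * _); rewrite mulrACA.
Qed.

(** The entry at (A, B) of the pairing: signed count of the pairs of a word
    of content [la] and a column permutation taking type [A] to type [B]. *)
Definition kostka_form N r (la mu : seq nat)
    (A B : {ffun 'I_N.+1 * 'I_N.+1 -> nat}) : k :=
  \sum_(w | content w == content (row_word N r la))
   \sum_(h in column_stabiliser r mu)
    (-1) ^+ h * ((jcount (row_word N r mu) w == A) &&
      (jcount (wact (row_word N r mu) h) w == B))%:R.

Lemma p_kostka_form_rank N b r la mu : is_part_of r la -> is_part_of r mu ->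
  (r <= N)%N -> (r <= b)%N ->
  p_kostka k r la mu =
  form_rank (fun A B : {ffun 'I_N.+1 * 'I_N.+1 -> 'I_b.+1} =>
    kostka_form r la mu (type_val A) (type_val B)).
Proof.
move=> hla hmu rN rb; rewrite (p_kostka_rank_orbit k hla hmu rN rb) /form_rank.
congr (\rank _); apply/matrixP => i j; rewrite [RHS]mxE /kostka_form.
rewrite -(sum_tabloid_word hla rN (fun w =>
  \sum_(h in column_stabiliser r mu) (-1) ^+ h * ((_ w == _) &&
  (jcount _ w == _))%:R)).
rewrite -mulmxA mxE [RHS]big_enum_val /=; apply: eq_bigr => x _; rewrite mxE.
have [|_] /= := eqVneq (jcount _ (tabloid_word N la (enum_val x))) _; last first.
  by rewrite mul0r big1 // => h _; rewrite mulr0.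
move=> _; rewrite mul1r mxE.
transitivity (\sum_(y < #|tabloids r la|) \sum_(h in column_stabiliser r mu)
    (-1) ^+ h * ((enum_val x :* h)%g == enum_val y)%:R *
      (orbit_sums k N b r la mu)^T y j).
  by apply: eq_bigr => y _; rewrite row_column_sum mulr_suml.
rewrite exchange_big /=; apply: eq_bigr => h hC.
have yT : (enum_val x :* h)%g \in tabloids r la by apply/rcoset_tabloid/enum_valP.
rewrite (bigD1 (enum_rank_in yT (enum_val x :* h)%g)) //= enum_rankK_in // eqxx
  mulr1.
rewrite !mxE enum_rankK_in // big1 ?addr0 => [|l lx]; last first.
  case: eqP => [xl|_]; last by rewrite mulr0 mul0r.
  by case/eqP: lx; apply: enum_val_inj; rewrite enum_rankK_in.
by rewrite (tabloid_word_act hla rN) ?enum_valP // jcount_wactl.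
Qed.

End Gamma.

(** * Triangular factorisations and the determinant of a diagram *)

Section LU.

Import GRing.Theory.
Local Open Scope ring_scope.

(** One more row and column at a time: the new entries of [L] and [U] are
    solutions of triangular systems, invertible since the previous leading minor
    is nonzero. *)
Lemma LU_exists (F : fieldType) n (Z : nat -> nat -> F) :
  (forall m, (m <= n)%N -> \det (\matrix_(i < m, j < m) Z i j) != 0) ->
  exists L U : nat -> nat -> F,
  [/\ forall i j, (i < j)%N -> L i j = 0, forall i, L i i = 1,
      forall i j, (j < i)%N -> U i j = 0
    & forall i j, (i < n)%N -> (j < n)%N -> Z i j = \sum_(l < n) L i l * U l j].
Proof.
elim: n => [|n IHn] minors.
  exists (fun i j => (i == j)%:R), (fun _ _ => 0); split=> // [i j ij|i].
    by rewrite ltn_eqF.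
  by rewrite eqxx.
have [m mn|L [U [Ltri L1 Utri ZE]]] := IHn; first by apply: minors; apply: leqW.
pose Ln := \matrix_(i < n, j < n) L i j; pose Un := \matrix_(i < n, j < n) U i j.
have ZLU : \matrix_(i < n, j < n) Z i j = Ln *m Un.
  by apply/matrixP => i j; rewrite !mxE ZE //; apply: eq_bigr => l _; rewrite !mxE.
have := minors n (leqnSn n); rewrite ZLU det_mulmx mulf_eq0 negb_or => /andP[dL dU].
have uL : Ln \in unitmx by rewrite unitmxE unitfE.
have uU : Un \in unitmx by rewrite unitmxE unitfE.
pose x := (\row_(j < n) Z n j) *m invmx Un.
pose y := invmx Ln *m (\col_(i < n) Z i n).
pose xf j := if insub j is Some l then x 0 l else 0.
pose yf i := if insub i is Some l then y l 0 else 0.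
have xfE (l : 'I_n) : xf l = x 0 l by rewrite /xf valK.
have yfE (l : 'I_n) : yf l = y l 0 by rewrite /yf valK.
(* The last diagonal entry of [U] absorbs what the other terms leave. *)
pose d := Z n n - \sum_(l < n) xf l * yf l.
exists (fun i j => if i == n then (if (j < n)%N then xf j else (j == n)%:R)
  else L i j).
exists (fun i j => if j == n then (if (i < n)%N then yf i else if i == n then d
  else 0) else U i j).
split.
- move=> i j ij; case: eqP ij => [-> nj|_ ij]; last exact: Ltri.
  by rewrite ltnNge ltnW // gtn_eqF.
- by move=> i; case: eqP => [->|//]; rewrite ltnn.
- move=> i j ji; case: eqP ji => [-> ni|_ ji]; last exact: Utri.
  by rewrite ltnNge ltnW // gtn_eqF.
move=> i j; rewrite !ltnS big_ord_recr /= eqxx ltnn => iLn jLn.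
have [->|i_n] := eqVneq i n; have [->|j_n] := eqVneq j n.
- under eq_bigr => l _ do rewrite ltn_ord.
  by rewrite mul1r /d addrC subrK.
- have jn : (j < n)%N by rewrite ltn_neqAle j_n.
  rewrite mul1r Utri // addr0.
  under eq_bigr => l _ do rewrite ltn_ord xfE.
  have : (x *m Un) 0 (Ordinal jn) = Z n j by rewrite mulmxKV // mxE.
  by move=> <-; rewrite mxE; apply: eq_bigr => l _; rewrite !mxE.
- have ilt : (i < n)%N by rewrite ltn_neqAle i_n.
  rewrite Ltri // mul0r addr0.
  under eq_bigr => l _ do rewrite ltn_ord yfE.
  have : (Ln *m y) (Ordinal ilt) 0 = Z i n by rewrite mulKVmx // mxE.
  by move=> <-; rewrite mxE; apply: eq_bigr => l _; rewrite !mxE.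
have ilt : (i < n)%N by rewrite ltn_neqAle i_n.
have jn : (j < n)%N by rewrite ltn_neqAle j_n.
by rewrite Ltri // mul0r addr0 ZE //; apply: eq_bigr => l _.
Qed.

End LU.

Section Diagram.

Import GRing.Theory.
Local Open Scope ring_scope.

Variables (N r : nat) (mu : seq nat).
Hypotheses (hmu : is_part_of r mu) (rN : (r <= N)%N).

(** The matrix [Z] copied along each column of the diagram.  Up to the order of
    the cells it is block diagonal, and its blocks are leading principal submatrices
    of [Z]; so its determinant is the product of leading principal minors D_mu(Z),
    without any reference to the heights of the columns. *)
Definition diagram_mx (R : comPzRingType) (Z : 'M[R]_N.+1) : 'M[R]_r :=
  \matrix_(c, d) (Z (row_word N r mu c) (row_word N r mu d) *+ (ccol mu c ==
    ccol mu d)).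
Definition diagram_det (R : comPzRingType) (Z : 'M[R]_N.+1) : R :=
  \det (diagram_mx Z).

(** A permutation that moves some cell out of its column contributes a zero
    factor. *)
Lemma diagram_det_expand (R : comPzRingType) (Z : 'M[R]_N.+1) :
  diagram_det Z = \sum_(h in column_stabiliser r mu) (-1) ^+ h *
    \prod_c Z (row_word N r mu c) (row_word N r mu (h c)).
Proof.
rewrite /diagram_det /determinant [RHS]big_mkcond /=; apply: eq_bigr => h _.
case: ifP => hC.
  congr (_ * _); apply: eq_bigr => c _; rewrite mxE.
  by have /mem_column/(_ c) -> := hC; rewrite eqxx.
have /existsP[c nc] : [exists c, ccol mu c != ccol mu (h c)].
  apply: contraFT hC; rewrite negb_exists => /forallP H.
  by apply/mem_column => c; apply/esym/eqP; rewrite -[_ == _]negbK.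
by rewrite (bigD1 c) //= mxE (negPf nc) mul0r mulr0.
Qed.

Lemma diagram_det_map (R S : comPzRingType) (f : {rmorphism R ->
  S}) (Z : 'M[R]_N.+1) :
  diagram_det (map_mx f Z) = f (diagram_det Z).
Proof.
rewrite /diagram_det -det_map_mx; congr (\det _); apply/matrixP => c d.
by rewrite !mxE rmorphMn.
Qed.

(** Copying along columns is compatible with the product [L *m U], because the
    columns have no gap: if the entry of [L] in the row of a cell [c] and in column
    m is nonzero, then row m is not below [c], so it meets the column of [c].  In
    reading order the copies of [L] and [U] are again triangular. *)
Lemma diagram_det_LU (R : comPzRingType) (L U : 'M[R]_N.+1) :
  (forall i j : 'I_N.+1, (i < j)%N -> L i j = 0) -> (forall i, L i i = 1) ->
  (forall i j : 'I_N.+1, (j < i)%N -> U i j = 0) ->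
  diagram_det (L *m U) = \prod_i U i i ^+ nth 0%N mu i.
Proof.
move=> Ltri L1 Utri.
have DLU : diagram_mx (L *m U) = diagram_mx L *m diagram_mx U.
  apply/matrixP => c d; rewrite !mxE.
  have [cd|cd] := eqVneq (ccol mu c) (ccol mu d); last first.
    rewrite mulr0n big1 // => e _; rewrite !mxE.
    have [ce|_] := eqVneq (ccol mu c) (ccol mu e); last by rewrite mul0r.
    by rewrite -ce (negPf cd) mulr0.
  rewrite mulr1n; pose Cs := [set e : 'I_r | ccol mu e == ccol mu c].
  have inj : {in Cs &, injective (row_word N r mu)}.
    move=> e e'; rewrite !inE => /eqP ec /eqP e'c /(congr1 val).
    by rewrite !(row_wordE hmu rN) => /(@cell_eq _ mu); apply; rewrite ec.
  pose F m := L (row_word N r mu c) m * U m (row_word N r mu d).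
  rewrite (bigID (mem (row_word N r mu @: Cs))) /= [X in _ + X]big1 => [|m mC];
    last first.
    rewrite Ltri ?mul0r // ltnNge; apply: contra mC.
    rewrite (row_wordE hmu rN) => /(part_noninc hmu) le.
    have [e [em ec]] := cell_ex hmu (leq_trans (ccol_lt hmu c) le).
    apply/imsetP; exists e; first by rewrite inE ec.
    by apply: val_inj; rewrite (row_wordE hmu rN).
  rewrite addr0 (big_imset F inj) /= big_mkcond /=; apply: eq_bigr => e _.
  rewrite !mxE inE /F; have [ec|ec] := eqVneq (ccol mu e) (ccol mu c).
    by rewrite ec cd eqxx !mulr1n.
  by rewrite mulr0n mul0r.
rewrite /diagram_det DLU det_mulmx.
have rowle (c d : 'I_r) : (c <= d)%N -> (crow mu c <= crow mu d)%N.
  by rewrite (reshape_leq mu) -/(crow mu c) -/(crow mu d) =>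
    /orP[/ltnW //|/andP[/eqP-> _]].
have same (c d : 'I_r) : ccol mu c = ccol mu d -> c != d -> (c < d)%N ->
  (crow mu c < crow mu d)%N.
  move=> cd ncd lt; rewrite ltn_neqAle rowle ?(ltnW lt) // andbT.
  by apply: contra_neq ncd => /(@cell_eq _ mu); apply.
have -> : \det (diagram_mx L) = 1.
  rewrite det_trig; last first.
    apply/is_trig_mxP => c d cd; rewrite mxE.
    have [ccd|_] := eqVneq (ccol mu c) (ccol mu d); last by [].
    by rewrite Ltri // !(row_wordE hmu rN) same // neq_ltn cd.
  by rewrite big1 // => c _; rewrite mxE eqxx L1.
rewrite mul1r -det_tr det_trig; last first.
  apply/is_trig_mxP => c d cd; rewrite !mxE.
  have [ccd|_] := eqVneq (ccol mu d) (ccol mu c); last by [].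
  by rewrite Utri // !(row_wordE hmu rN) same // neq_ltn cd.
rewrite (partition_big (row_word N r mu) xpredT) //=; apply: eq_bigr => i _.
rewrite -(card_crow hmu) -prodr_const; apply: eq_big => [c|c /eqP <-].
  by rewrite inE -(row_wordE hmu rN).
by rewrite !mxE eqxx.
Qed.

End Diagram.

Section Generic.

Import GRing.Theory.
Local Open Scope ring_scope.

(** Over the fractions of [{poly R}], the matrix ['X + Z] has nonzero leading
    minors, since they are characteristic polynomials. *)
Lemma LU_generic (R : idomainType) N (Z : 'M[R]_N.+1) :
  let Zt := map_mx (@tofrac {poly R}) ('X%:M + map_mx polyC Z) in
  exists L U : 'M_N.+1, [/\ Zt = L *m U,
    forall i j : 'I_N.+1, (i < j)%N -> L i j = 0, forall i, L i i = 1
    & forall i j : 'I_N.+1, (j < i)%N -> U i j = 0].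
Proof.
move=> Zt; pose Zn (i j : nat) := Zt (inord i) (inord j).
have [m mN|L [U [Ltri L1 Utri ZE]]] := @LU_exists _ N.+1 Zn.
  pose Zm := \matrix_(i < m, j < m) Z (inord i) (inord j).
  have -> : \matrix_(i < m, j < m) Zn i j =
    map_mx (@tofrac _) (char_poly_mx (- Zm)).
    apply/matrixP => i j; rewrite !mxE -polyCN opprK /Zn /Zt !mxE.
    suff -> : (inord i == inord j :> 'I_N.+1) = (i == j) by [].
    by rewrite -(inj_eq val_inj) /= !inordK // ?(leq_trans (ltn_ord _)).
  by rewrite det_map_mx tofrac_eq0 monic_neq0 // char_poly_monic.
exists (\matrix_(i, j) L i j), (\matrix_(i, j) U i j); split.
- apply/matrixP => i j; rewrite [RHS]mxE; have := ZE i j (ltn_ord _) (ltn_ord _).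
  rewrite /Zn !inord_val => ->; apply: eq_bigr => l _.
  by rewrite !mxE.
- by move=> i j ij; rewrite mxE Ltri.
- by move=> i; rewrite mxE L1.
- by move=> i j ij; rewrite mxE Utri.
Qed.

(** Both sides agree for ['X + Z], by triangular factorisation; then set
    ['X = 0]. *)
Lemma diagram_det_shape_add (R : idomainType) N r mu a de s nu q (Z : 'M[R]_N.+1) :
  is_part_of r mu -> is_part_of a de -> is_part_of s nu ->
  (r <= N)%N -> (a <= N)%N -> (s <= N)%N ->
  (forall i, nth 0 nu i = nth 0 mu i + q * nth 0 de i)%N ->
  diagram_det s nu Z = diagram_det r mu Z * diagram_det a de Z ^+ q.
Proof.
move=> hmu hde hnu rN aN sN nuE; have := LU_generic Z => /=.
set Zt := ('X%:M + _) => -[L [U [ZE Ltri L1 Utri]]].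
have : diagram_det s nu Zt = diagram_det r mu Zt * diagram_det a de Zt ^+ q.
  apply/eqP; rewrite -tofrac_eq; apply/eqP;
    rewrite rmorphM rmorphXn -!diagram_det_map ZE.
  rewrite !diagram_det_LU // -prodrXl -big_split /=; apply: eq_bigr => i _.
  by rewrite nuE exprD mulnC exprM.
move/(congr1 (horner_eval 0)); rewrite rmorphM rmorphXn -!diagram_det_map.
suff -> : map_mx (horner_eval 0) Zt = Z by [].
apply/matrixP => i j; rewrite !mxE /horner_eval hornerD hornerC hornerMn hornerX.
by rewrite mul0rn add0r.
Qed.

End Generic.

(** * Generating functions and Frobenius *)

Section Convolution.

Import GRing.Theory.
Local Open Scope ring_scope.

Variables (k : fieldType) (N : nat).

Local Notation I := ('I_N.+1 * 'I_N.+1)%type.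
Local Notation fty := {ffun I -> nat}.

(** The form of [mu] for all contents at once. *)
Definition young_form r mu (A B : fty) : k :=
  \sum_w \sum_(h in column_stabiliser r mu)
    (-1) ^+ h * ((jcount (row_word N r mu) w == A) &&
      (jcount (wact (row_word N r mu) h) w == B))%:R.

(** The monomial X ^ A Y ^ B; the boolean in an index tells X from Y. *)
Definition bimon (A B : fty) : 'X_{1..#|{: bool * I}|} :=
  [multinom (let x := enum_val i in if x.1 then A x.2 else B x.2)
    | i < #|{: bool * I}|].

Lemma bimonE A B i : bimon A B i =
  let x := enum_val i in if x.1 then A x.2 else B x.2.
Proof.
exact: (@mnmE _ (fun i => let x := enum_val i in if x.1 then A x.2 else B x.2)).
Qed.

Lemma bimon_eq A B A' B' : (bimon A B == bimon A' B') = (A == A') && (B == B').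
Proof.
apply/eqP/andP => [/mnmP e|[/eqP-> /eqP->] //].
by split; apply/eqP/ffunP => x;
  [have := e (enum_rank (true, x)) | have := e (enum_rank (false, x))];
  rewrite !mnmE !enum_rankK.
Qed.

Definition add_types q (A B : fty) : fty := [ffun x => A x + q * B x]%N.

Lemma bimonD q A B A' B' :
  (bimon A B + bimon A' B' *+ q)%MM = bimon (add_types q A A') (add_types q B B').
Proof.
apply/mnmP => i; rewrite mnmDE mulmnE !bimonE /=.
by case: ifP => _; rewrite ffunE mulnC.
Qed.

Definition varmx (t : bool) : 'M[{mpoly k[#|{: bool * I}|]}]_N.+1 :=
  \matrix_(i, j) 'X_(enum_rank (t, (i, j))).

Lemma prod_varmx r (u v w : {ffun 'I_r -> 'I_N.+1}) :
  \prod_c (varmx true (u c) (w c) * varmx false (v c) (w c)) =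
    'X_[bimon (jcount u w) (jcount v w)].
Proof.
under eq_bigr do rewrite !mxE -mpolyXD.
rewrite -(big_morph (fun m => 'X_[m] : {mpoly k[_]}) (@mpolyXD _ _) (@mpolyX0 _ _)).
congr 'X_[_]; apply/mnmP => i.
rewrite mnm_sumE bimonE -[in LHS](enum_valK i).
case: (enum_val i) => [[] x] /=; rewrite ffunE -sum1dep_card [RHS]big_mkcond /=;
  apply: eq_bigr => c _; rewrite mnmDE !mnm1E !(inj_eq enum_rank_inj)
    !xpair_eqE /= ?addn0.
  by case: x => x y; rewrite xpair_eqE; case: (_ && _).
by case: x => x y; rewrite xpair_eqE; case: (_ && _).
Qed.

Local Notation Z := (varmx true *m (varmx false)^T).

(** The generating function D_mu(X Y^T) of the form: choosing an index in
    each entry of the product X Y^T amounts to choosing a word. *)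
Lemma diagram_det_varmx r mu : diagram_det r mu Z =
  \sum_w \sum_(h in column_stabiliser r mu)
   (-1) ^+ h * 'X_[bimon (jcount (row_word N r mu) w) 
       (jcount (wact (row_word N r mu) h) w)].
Proof.
rewrite diagram_det_expand exchange_big /=; apply: eq_bigr => h _.
rewrite -mulr_sumr; congr (_ * _).
under eq_bigr do rewrite mxE.
rewrite bigA_distr_bigA /=; apply: eq_bigr => w _.
rewrite -prod_varmx; apply: eq_bigr => c _; congr (_ * _).
by rewrite [LHS]mxE [wact _ _ _]ffunE.
Qed.

Lemma mcoeff_sign n (b : nat) (P : {mpoly k[n]}) m :
  ((-1) ^+ b * P)@_m = (-1) ^+ b * P@_m.
Proof.
rewrite -signr_odd -[in RHS]signr_odd; case: (odd b).
  by rewrite !expr1 !mulN1r mcoeffN.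
by rewrite !expr0 !mul1r.
Qed.

Variables (p n : nat).
Hypotheses (hp : prime p) (hk : p \in [pchar k]).

(** Coefficients of [diagram_det_shape_add] for X Y^T.  The q-th power of a sum
    of monomials with signs is the sum of their q-th powers, with the same signs. *)
Lemma young_form_conv r mu a de s nu A B :
  is_part_of r mu -> is_part_of a de -> is_part_of s nu ->
  (r <= N)%N -> (a <= N)%N -> (s <= N)%N ->
  (forall i, nth 0 nu i = nth 0 mu i + p ^ n * nth 0 de i)%N ->
  young_form s nu A B = \sum_w \sum_(h in column_stabiliser r mu) \sum_w'
    \sum_(h' in column_stabiliser a de)
    ((-1) ^+ h * (-1) ^+ h') *
    ((add_types (p ^ n)%N (jcount (row_word N r mu) w)
                          (jcount (row_word N a de) w') == A) &&
     (add_types (p ^ n)%N (jcount (wact (row_word N r mu) h) w)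
                          (jcount (wact (row_word N a de) h') w') == B))%:R.
Proof.
move=> hmu hde hnu rN aN sN nuE.
have cP : p \in [pchar {mpoly k[#|{: bool * I}|]}].
  apply/andP; split=> //; have /andP[_ /eqP p0] := hk.
  by rewrite -mpolyC_nat p0 mpolyC0.
have qP : [pchar {mpoly k[#|{: bool * I}|]}].-nat (p ^ n)%N.
  by rewrite pnatX; apply/orP; left; rewrite pnatE.
have := diagram_det_shape_add Z hmu hde hnu rN aN sN nuE.
move/(congr1 (mcoeff (bimon A B))).
rewrite !diagram_det_varmx.
have -> : mcoeff (bimon A B) (\sum_w \sum_(h in column_stabiliser s nu)
   (-1) ^+ h * 'X_[bimon (jcount (row_word N s nu) w)
                         (jcount (wact (row_word N s nu) h) w)]) = young_form s nu A B.
  rewrite raddf_sum; apply: eq_bigr => w _; rewrite raddf_sum;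
    apply: eq_bigr => h _.
  by rewrite /= mcoeff_sign mcoeffX bimon_eq.
move=> ->.
have sumX (J : finType) (P : pred J) (F : J -> {mpoly k[#|{: bool * I}|]}) :
    (\sum_(j | P j) F j) ^+ (p ^ n)%N = \sum_(j | P j) F j ^+ (p ^ n)%N.
  apply: (big_morph (fun x => x ^+ (p ^ n)%N)) => [x y|]; first exact: exprDn_pchar.
  by rewrite expr0n expn_eq0 (gtn_eqF (prime_gt0 hp)).
rewrite sumX big_distrl raddf_sum /=; apply: eq_bigr => w _.
rewrite big_distrl raddf_sum /=; apply: eq_bigr => h _.
rewrite big_distrr raddf_sum /=; apply: eq_bigr => w' _.
rewrite sumX big_distrr raddf_sum /=; apply: eq_bigr => h' _.
have -> : ((-1) ^+ h' *
      'X_[bimon (jcount (row_word N a de) w')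
                (jcount (wact (row_word N a de) h') w')]) ^+ (p ^ n)%N =
    (-1) ^+ h' *
      'X_[bimon (jcount (row_word N a de) w')
                (jcount (wact (row_word N a de) h') w') *+ (p ^ n)%N]
   :> {mpoly k[#|{: bool * I}|]}.
  by case: (odd_perm h'); rewrite ?expr1 ?expr0 ?mulN1r ?mul1r ?exprNn_pchar //
    mpolyXn.
by rewrite mulrACA -mpolyXD -mulrA !mcoeff_sign mcoeffX bimonD bimon_eq mulrA.
Qed.

End Convolution.

(** * The antidiagonal monomial *)

Section Reversal.

Variables (N r : nat) (mu : seq nat).
Hypotheses (hmu : is_part_of r mu) (rN : r <= N).

(** The height of column [j], that is, the conjugate partition. *)
Definition height (j : nat) : nat := find (fun x => x <= j) mu.

Lemma heightP i j : (i < height j) = (j < nth 0 mu i).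
Proof.
apply/idP/idP => [/(before_find 0) /negbT|]; first by rewrite ltnNge.
rewrite ltnNge => H; rewrite ltnNge; apply: contra H => /(part_noninc hmu) le.
apply: leq_trans le _.
have [hs|hs] := boolP (has (fun x => x <= j) mu); first exact: (nth_find 0 hs).
by rewrite nth_default // /height hasNfind.
Qed.

Definition colrev0 (c : 'I_r) : 'I_r :=
  cellat mu c (height (ccol mu c) - (crow mu c).+1) (ccol mu c).

Lemma crow_height (c : 'I_r) : crow mu c < height (ccol mu c).
Proof. by rewrite heightP ccol_lt. Qed.

Lemma colrev0P c : crow mu (colrev0 c) = height (ccol mu c) - (crow mu c).+1 /\
  ccol mu (colrev0 c) = ccol mu c.
Proof.
apply: (cellatP hmu); rewrite -heightP.
by rewrite -subSn ?crow_height // subSS leq_subr.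
Qed.

Lemma colrev0_inj : injective colrev0.
Proof.
move=> c d e; have [rc cc] := colrev0P c; have [rd cd] := colrev0P d.
have colE : ccol mu c = ccol mu d by rewrite -cc -cd e.
apply: (@cell_eq _ mu _ _ _ colE); have := crow_height c; have := crow_height d.
move: rd; rewrite -e rc colE => er h1 h2.
by apply: succn_inj; rewrite -(subKn h1) -er subKn.
Qed.

Definition colrev : 'S_r := perm colrev0_inj.

Lemma crow_colrev c : crow mu (colrev c) = height (ccol mu c) - (crow mu c).+1.
Proof. by rewrite permE; case: (colrev0P c). Qed.

Lemma colrev_column : colrev \in column_stabiliser r mu.
Proof. by apply/mem_column => c; rewrite permE; case: (colrev0P c). Qed.

(** A cell of row i is sent to row j if its column has height i + j + 1, and
    there are mu_(i+j) - mu_(i+j+1) such columns. *)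
Lemma colrev_type_lt q x : (forall i, nth 0 mu i - nth 0 mu i.+1 < q) ->
  jcount (row_word N r mu) (wact (row_word N r mu) colrev) x < q.
Proof.
move=> muq; case: x => i j; rewrite ffunE.
apply: leq_ltn_trans (muq (i + j)); set S := [set c | _].
rewrite cardE -(size_map (@ccol r mu)) -(size_iota (nth 0 mu (i + j).+1) (_ - _)).
have SE c : c \in S -> crow mu c = i /\ height (ccol mu c) = (i + j).+1.
  rewrite inE [wact _ _ _]ffunE xpair_eqE -!(inj_eq val_inj) !(row_wordE hmu
    rN) crow_colrev.
  case/andP => /eqP ri /eqP /= rj; have := crow_height c;
    rewrite -rj ri /= => ht; split=> //; lia.
apply: uniq_leq_size.
  rewrite map_inj_in_uniq ?enum_uniq // => c d;
    rewrite !mem_enum => /SE[rc _] /SE[rd _].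
  by apply: (@cell_eq _ mu); rewrite rc rd.
move=> y /mapP[c]; rewrite mem_enum => /SE[rc hc] ->.
rewrite mem_iota; apply/andP; split.
  by rewrite leqNgt -heightP hc ltnn.
rewrite subnKC -?heightP ?hc //.
exact: (part_noninc hmu).
Qed.

(** The antidiagonal monomial has coefficient 1 or -1 in D_mu.  By induction on
    the rows: the reversal sends a cell of row i as low as possible once the i
    lowest rows of its column are taken by the cells above, so that no [h] that
    agrees with it on these can go lower; but the type gives the sum over row i of
    the rows of the images, and equality must hold everywhere. *)
Lemma colrev_unique h : h \in column_stabiliser r mu ->
  jcount (row_word N r mu) (wact (row_word N r mu) h) =
    jcount (row_word N r mu) (wact (row_word N r mu) colrev) ->
  h = colrev.
Proof.
move=> /mem_column hC /same_jcount_perm[s [sY hs]].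
have rs c : crow mu (s c) = crow mu c.
  by have /ffunP/(_ c)/(congr1 val) := sY; rewrite ffunE !(row_wordE hmu rN).
have hsE c : crow mu (h c) = crow mu (colrev (s c)).
  by have /ffunP/(_ c)/(congr1 val) := hs;
    rewrite ![wact _ _ _]ffunE !(row_wordE hmu rN).
suff rows i : forall c, crow mu c = i -> crow mu (h c) = crow mu (colrev c).
  apply/permP => c; apply: (@cell_eq _ mu); first exact: (rows _ c).
  by rewrite hC; have /mem_column -> := colrev_column.
elim/ltn_ind: i => i IHi.
have le c : crow mu c == i -> crow mu (h c) <= crow mu (colrev c).
  move=> /eqP ci; rewrite crow_colrev ci; have hlt := crow_height (h c).
  rewrite hC in hlt; set H := height _ in hlt *.
  rewrite leqNgt; apply/negP => gt.
  set m := crow mu (h c) in hlt gt.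
  have i'i : H - m.+1 < i by lia.
  have [c' [rc' cc']] : exists c' : 'I_r,
      crow mu c' = H - m.+1 /\ ccol mu c' = ccol mu c.
    by apply: (cell_ex hmu); rewrite -heightP -/H; lia.
  have hc' : h c' = h c.
    apply: (@cell_eq _ mu); last by rewrite !hC.
    by rewrite (IHi _ i'i c' rc') crow_colrev cc' rc' -/H -/m; lia.
  by move/perm_inj: hc' => hc'; move: i'i; rewrite -rc' hc' ci ltnn.
have sumE : \sum_(c | crow mu c == i) crow mu (h c) =
  \sum_(c | crow mu c == i) crow mu (colrev c).
  rewrite [RHS](reindex_inj (@perm_inj _ s)); apply: eq_big => c;
    first by rewrite rs.
  by rewrite hsE.
move=> c /eqP ci.
have := leqif_sum (fun c (ci : crow mu c == i) => leqif_eq (le c ci)).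
case=> _; rewrite sumE eqxx => /esym/forallP/(_ c); rewrite ci => /eqP.
exact.
Qed.

End Reversal.

(** * Counting words modulo p *)

Lemma cycle_perm_exists (T : finType) (s : seq T) : uniq s ->
  exists2 t : {perm T}, (t ^+ size s = 1)%g & forall x, t x = next s x.
Proof.
move=> us; exists (perm (can_inj (prev_next us))) => [|x]; last by rewrite permE.
apply/permP => x; rewrite permX perm1.
have iterE m : iter m (perm (can_inj (prev_next us))) x = iter m (next s) x.
  by elim: m => //= m IHm; rewrite IHm permE.
rewrite iterE; have [xs|xs] := boolP (x \in s); last first.
  have nx : next s x = x by rewrite next_nth (negPf xs).
  by elim: {1}(size s) => //= m IHm; rewrite IHm.
have fc : fcycle (next s) s by apply: cycle_next.
by rewrite -(order_cycle fc us xs); apply: iter_order (can_inj (prev_next us)) _.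
Qed.

Section Truncation.

Variables (N r : nat).
Implicit Types (u v w : {ffun 'I_r -> 'I_N.+1}).

(** The inverse turns the left action [wact] into a right action. *)
Definition wact_to v (h : 'S_r) := wact v h^-1%g.

Lemma wact_to1 v : wact_to v 1%g = v.
Proof. by rewrite /wact_to invg1 wact1. Qed.

Lemma wact_toM v : act_morph wact_to v.
Proof. by move=> g h; rewrite /wact_to invMg wactM. Qed.

Definition wact_action := TotalAction wact_to1 wact_toM.

(** The coefficient of X ^ A in a product of entries of X g vanishes modulo p
    when some entry occurs at least q times and the exponents in A are less
    than q.  Concretely, a cycle on q of the cells where ([u], [w]) takes a value
    occurring too often acts on the words [v]; a fixed [v] is constant on these
    cells, which contradicts the bound on [A]. *)
Lemma card_types_mod (p n : nat) u w (A E : {ffun 'I_N.+1 * 'I_N.+1 -> nat}) :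
  prime p -> (forall x, A x < p ^ n) -> ~~ [forall x, jcount u w x < p ^ n] ->
  p %| #|[set v | (jcount u v == A) && (jcount v w == E)]|.
Proof.
move=> hp Aq; rewrite negb_forall => /existsP[[i j]];
  rewrite -leqNgt ffunE cardE => Sq.
set S := [set c | _] in Sq; pose s := take (p ^ n) (enum S).
have us : uniq s by apply/take_uniq/enum_uniq.
have ss : size s = p ^ n by rewrite size_takel.
have sS c : c \in s -> (u c = i /\ w c = j).
  by move/mem_take; rewrite mem_enum inE xpair_eqE => /andP[/eqP-> /eqP->].
have [t tq tE] := cycle_perm_exists us; rewrite ss in tq.
have fixS v : (forall c, c \in s -> v c = v (next s c)) -> wact v t = v.
  move=> vs; apply/ffunP => c; rewrite ffunE tE;
    have [/vs //|cs] := boolP (c \in s).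
  by rewrite next_nth (negPf cs).
have ut : wact u t = u.
  by apply: fixS => c cs; have [-> _] := sS _ cs;
    have [|-> //] := sS (next s c); rewrite mem_next.
have wt : wact w t = w.
  by apply: fixS => c cs; have [_ ->] := sS _ cs;
    have [|_ -> //] := sS (next s c); rewrite mem_next.
have ut' : wact u t^-1%g = u by rewrite -{1}ut -wactM mulVg wact1.
have wt' : wact w t^-1%g = w by rewrite -{1}wt -wactM mulVg wact1.
pose X := [set v | (jcount u v == A) && (jcount v w == E)].
have pP : (p.-group <[t]>)%g.
  rewrite /pgroup -orderE; apply: (pnat_dvd (n := p ^ n));
    first by rewrite order_dvdn tq.
  by rewrite pnatX pnat_id.
have actX : [acts <[t]>, on X | wact_action]%g.
  rewrite cycle_subG; apply/astabsP => v; rewrite !inE /= /wact_to.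
  have := jcount_wact u v t^-1%g; rewrite ut' => ->.
  by have := jcount_wact v w t^-1%g; rewrite wt' => ->.
have := pgroup_fix_mod pP actX.
suff -> : ('Fix_(X | wact_action)(<[t]>))%g = set0.
  by rewrite cards0 /dvdn => ->; rewrite mod0n.
apply/eqP; rewrite -subset0; apply/subsetP => v; rewrite inE afix_cycle.
case/andP; rewrite inE => /andP[/eqP vA _] /afix1P /= vt.
have {}vt : wact v t = v by rewrite -[in LHS]vt -wactM mulgV wact1.
have [x0 x0s] : exists x0, x0 \in s.
  case: (s) ss => [/= e|x l _]; last by exists x; rewrite mem_head.
  by have := expn_gt0 p n; rewrite -e (prime_gt0 hp).
have vconst c : c \in s -> v c = v x0.
  rewrite -(fconnect_cycle (cycle_next us) x0s) => /iter_findex <-.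
  elim: (findex _ _ _) => //= m <-; rewrite -tE -[in RHS]vt.
  by rewrite [in RHS]ffunE.
have := Aq (i, v x0); rewrite -vA ffunE ltnNge => /negP[].
rewrite -ss cardE; apply: uniq_leq_size => // c cs; rewrite mem_enum inE.
by rewrite vconst //; have [-> _] := sS c cs.
Qed.

End Truncation.

(** * Truncation to types with small entries *)

Section TruncationIdentity.

Import GRing.Theory.
Local Open Scope ring_scope.

Variables (k : fieldType) (N r : nat) (mu : seq nat).
Hypotheses (hmu : is_part_of r mu) (rN : (r <= N)%N).
Implicit Types (u v w : {ffun 'I_r -> 'I_N.+1}).

Local Notation I := ('I_N.+1 * 'I_N.+1)%type.
Local Notation fty := {ffun I -> nat}.
Local Notation rw := (row_word N r mu).
Local Notation C := (column_stabiliser r mu).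

Definition tcontent (A : fty) : {ffun 'I_N.+1 -> nat} :=
  [ffun j => \sum_i A (i, j)]%N.

Lemma tcontent_jcount u w : tcontent (jcount u w) = content w.
Proof.
apply/ffunP => j; rewrite !ffunE -sum1dep_card (partition_big u xpredT) //=.
apply: eq_bigr => i _; rewrite ffunE -sum1dep_card; apply: eq_bigl => c.
by rewrite xpair_eqE andbC.
Qed.

(** With [rw] replaced by any word [v] in the first type only: the coefficients
    of E_v(g Y^T), where E_v(H) is the determinant obtained by taking row
    v c of H for each cell c. *)
Definition twisted_form (E B : fty) v : k :=
  \sum_(w | jcount v w == E) \sum_(h in C) (-1) ^+ h *
    (jcount (wact rw h) w == B)%:R.

Lemma young_form_twisted E B : young_form k r mu E B = twisted_form E B rw.
Proof.
rewrite /young_form /twisted_form [RHS]big_mkcond; apply: eq_bigr => w _;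
  case: ifP => _ //.
by rewrite big1 // => h _; rewrite mulr0.
Qed.

Lemma twisted_form_column E B g : g \in C ->
  twisted_form E B (wact rw g) = (-1) ^+ g * twisted_form E B rw.
Proof.
move=> gC; rewrite /twisted_form mulr_sumr.
have winj : injective (fun w => wact w g).
  by move=> w w' e; rewrite -(wact1 w) -(wact1 w') -(mulVg g) !wactM e.
rewrite (reindex_inj winj) /=; apply: eq_big => [w|w _];
  first by rewrite jcount_wact.
rewrite mulr_sumr (reindex_inj (mulgI g)) /=; apply: eq_big => [h|h _].
  by rewrite groupMl.
by rewrite odd_permM signr_addb wactM jcount_wact mulrA.
Qed.

Lemma twisted_form_eq0 E B v c d : c != d -> v c = v d ->
  ccol mu c = ccol mu d -> twisted_form E B v = 0.
Proof.
move=> cd vcd ccd; rewrite /twisted_form exchange_big /=.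
under eq_bigr do rewrite -mulr_sumr.
apply: (@signed_sum_eq0 _ _ _ (tperm c d)).
- by rewrite odd_tperm.
- by move=> h; rewrite groupMl // tperm_column.
move=> h _; have vt : wact v (tperm c d) = v.
  by apply/ffunP => x; rewrite ffunE; case: tpermP => [->|->|].
have winj : injective (fun w => wact w (tperm c d)).
  by move=> w w' e; rewrite -(wact1 w) -(wact1 w') -(mulVg (tperm c d)) !wactM e.
rewrite (reindex_inj winj) /=; apply: eq_big => [w|w _].
  by rewrite -[v in LHS]vt jcount_wact.
by rewrite wactM jcount_wact.
Qed.

Local Notation h0 := (colrev hmu).
Local Notation A0 := (jcount rw (wact rw h0)).

(** The coefficient of X ^ A0 in D_mu(X H), for H = g Y^T, is D_mu(H) up to sign:
    the words [v] of type [A0] have content [mu], so by the lemma of James they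
    either have a repeated colour in a column, and contribute 0, or come from a
    column permutation, which must be the reversal. *)
Lemma sum_twisted_form E B : \sum_(v | jcount rw v == A0) twisted_form E B v =
  (-1) ^+ h0 * young_form k r mu E B.
Proof.
rewrite young_form_twisted -(twisted_form_column _ _ (colrev_column hmu)).
rewrite (bigD1 (wact rw h0)) //= big1 ?addr0 // => v /andP[/eqP vA nv].
have [winj|nwinj] := pselect (forall c d, v c = v d -> ccol mu c = ccol mu d ->
  c = d).
  have [j|c d|h hC hE] := @column_injective_word r mu hmu (fun c => val (v c)).
  - have cv : content v = content rw by rewrite -(tcontent_jcount rw) vA
    tcontent_jcount content_wact.
    rewrite -(card_crow hmu); have [jN|Nj] := ltnP j N.+1.
      have /ffunP/(_ (Ordinal jN)) := cv; rewrite !ffunE => e.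
      transitivity #|[set c | v c == Ordinal jN]|;
        first by apply: eq_card => c; rewrite !inE.
      by rewrite e; apply: eq_card => c; rewrite !inE -(row_wordE hmu rN).
    rewrite !eq_card0 // => c; rewrite !inE; apply/eqP => e.
      by have := row_wordE hmu rN c; rewrite e => e'; have := ltn_ord (rw c);
        rewrite [X in (X < _)%N -> _]e' ltnNge Nj.
    by have := ltn_ord (v c); rewrite [X in (X < _)%N -> _]e ltnNge Nj.
  - by move/val_inj/winj.
  have vE : v = wact rw h.
    by apply/ffunP => c; apply: val_inj;
      rewrite [wact _ _ _]ffunE (row_wordE hmu rN) -hE.
  by case/eqP: nv; rewrite vE (@colrev_unique N r mu hmu rN h hC) // -vE vA.
have [c [d [cd vcd ccd]]] : exists c d, [/\ c != d, v c = v d & ccol mu c =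
  ccol mu d].
  apply: contrapT => nex; apply: nwinj => c d vcd ccd.
  by apply: contrapT => /eqP cd; apply: nex; exists c, d; split.
exact: twisted_form_eq0 cd vcd ccd.
Qed.

(** The coefficient of X ^ A0 g ^ E in (X g) ^ A, where A is the type of [w]. *)
Definition transfer_count (E : fty) w : nat :=
  #|[set v | (jcount rw v == A0) && (jcount v w == E)]|.

Lemma young_form_transfer E B : (-1) ^+ h0 * young_form k r mu E B =
  \sum_w (transfer_count E w)%:R * \sum_(h in C) (-1) ^+ h *
    (jcount (wact rw h) w == B)%:R.
Proof.
rewrite -sum_twisted_form /twisted_form (exchange_big_dep xpredT) //=;
  apply: eq_bigr => w _.
rewrite sumr_const -[LHS]mulr_natl; congr (_ * _); rewrite /transfer_count.
by congr _%:R; apply: eq_card => v; rewrite [RHS]inE.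
Qed.

Lemma transfer_count_type E w w' : jcount rw w = jcount rw w' ->
  transfer_count E w = transfer_count E w'.
Proof.
case/same_jcount_perm => g [rg ->]; rewrite /transfer_count.
have winj : injective (fun w => wact w g).
  by move=> u u' e; rewrite -(wact1 u) -(wact1 u') -(mulVg g) !wactM e.
rewrite -[RHS](card_imset _ winj); apply: eq_card => v; rewrite inE.
apply/idP/imsetP => [/andP[vA vE]|[u]].
  exists (wact v g^-1%g); last by rewrite -wactM mulgV wact1.
  rewrite inE -(jcount_wact _ _ g) -(jcount_wact _ w' g) rg -!wactM mulgV wact1.
  by rewrite vA vE.
by rewrite inE => /andP[uA uE] ->; rewrite -[rw]rg !jcount_wact uE andbT rg.
Qed.

Variables (b p n : nat).
Hypotheses (hp : prime p) (hk : p \in [pchar k]) (rb : (r <= b)%N).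
Hypothesis muq : forall i, (nth 0 mu i - nth 0 mu i.+1 < p ^ n)%N.

Local Notation FT := {ffun I -> 'I_b.+1}.

(** Each row of the form is a combination of rows indexed by types with small
    entries and the same content. *)
Lemma young_form_truncation : exists c : FT -> FT -> k,
  (forall E B, young_form k r mu (type_val E) B =
    \sum_A c E A * young_form k r mu (type_val A) B) /\
  (forall E A, c E A != 0 -> (forall x, type_val A x < p ^ n)%N /\
    tcontent (type_val A) = tcontent (type_val E)).
Proof.
pose c (E A : FT) : k := (-1) ^+ h0 *
  (if [pick w | jcount rw w == type_val A] is Some w then (transfer_count
    (type_val E) w)%:R else 0).
exists c; split=> [E B|E A].
  have -> : young_form k r mu (type_val E) B =
    (-1) ^+ h0 * ((-1) ^+ h0 * young_form k r mu (type_val E) B).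
    by rewrite mulrA -signr_addb addbb expr0 mul1r.
  rewrite young_form_transfer mulr_sumr.
  under [RHS]eq_bigr do rewrite young_form_twisted /twisted_form mulr_sumr.
  rewrite (exchange_big_dep xpredT) //=; apply: eq_bigr => w _.
  rewrite -mulr_suml mulrA; congr (_ * _).
  rewrite (big_pred1 (type_of b (jcount rw w))) => [|A]; last first.
    apply/eqP/eqP => [e|->]; last by rewrite type_ofK // => x; apply: jcount_le.
    by apply: type_val_inj; rewrite type_ofK // => x; apply: jcount_le.
  rewrite /c type_ofK; last by move=> x; apply: jcount_le.
  by case: pickP => [w' /eqP/(transfer_count_type (type_val E)) -> //|/(_ w)];
    rewrite eqxx.
rewrite /c mulf_eq0 negb_or signr_eq0 /=; case: pickP => [w /eqP wA|_];
  last by rewrite eqxx.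
move=> nz; split.
  apply/forallP; rewrite -wA; apply: contraR nz => big.
  have := @card_types_mod N r p n rw w A0 (type_val E) hp (fun x =>
    colrev_type_lt hmu rN x muq) big.
  by rewrite -/(transfer_count _ _) (dvdn_pcharf hk).
have [v] : exists v, v \in [set v | (jcount rw v == A0) &&
  (jcount v w == type_val E)].
  by apply/set0Pn; apply: contra_neq nz => e; rewrite /transfer_count e cards0.
by rewrite inE => /andP[_ /eqP <-]; rewrite -wA !tcontent_jcount.
Qed.

End TruncationIdentity.

(** * Arithmetic of partitions *)

Section Partitions.

Lemma nth_addpart la mu i : nth 0 (addpart la mu) i = nth 0 la i + nth 0 mu i.
Proof.
have [lt|le] := ltnP i (maxn (size la) (size mu)); first by rewrite nth_mkseq.
rewrite nth_default ?size_mkseq //.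
by move: le; rewrite geq_max => /andP[h1 h2]; rewrite !nth_default.
Qed.

Lemma nth_scalepart c la i : nth 0 (scalepart c la) i = c * nth 0 la i.
Proof.
have [lt|le] := ltnP i (size la); first by rewrite (nth_map 0).
by rewrite !nth_default ?size_map // muln0.
Qed.

Lemma sumn_nth la M : size la <= M -> sumn la = \sum_(i < M) nth 0 la i.
Proof.
move=> le; rewrite sumnE (big_nth 0) big_mkord (big_ord_widen _ (fun i =>
  nth 0 la i) le).
rewrite [RHS](bigID (fun i : 'I_M =>
  i < size la)) /= [X in _ = _ + X]big1 ?addn0 // => i.
by rewrite -leqNgt => h; rewrite nth_default.
Qed.

Lemma nth_part_gt0 r la i : is_part_of r la -> i < size la -> 0 < nth 0 la i.
Proof.
case/andP => /andP[_ n0] _ lt; rewrite lt0n; apply: contraNneq n0 => <-.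
exact: mem_nth.
Qed.

Lemma add_scale_part r a la al q : 0 < q -> is_part_of r la -> is_part_of a al ->
  is_part_of (r + q * a) (addpart la (scalepart q al)).
Proof.
move=> q0 hla hal; have sz : size (addpart la (scalepart q al)) =
  maxn (size la) (size al).
  by rewrite size_mkseq size_map.
apply/andP; split; first (apply/andP; split).
- apply/(sortedP 0) => i _; rewrite !nth_addpart !nth_scalepart /=.
  by rewrite /geq /= leq_add ?leq_mul2l ?(part_noninc hla) ?(part_noninc hal) ?orbT.
- apply/negP => /(nthP 0)[i];
  rewrite sz leq_max nth_addpart nth_scalepart => lt /eqP.
  rewrite addn_eq0 muln_eq0 (gtn_eqF q0) /= => /andP[].
  by case/orP: lt => lt; [move/eqP => e _ | move=> _ /eqP e];
    [have := nth_part_gt0 hla lt | have := nth_part_gt0 hal lt]; rewrite e.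
rewrite (@sumn_nth _ (maxn (size la) (size al))) ?sz //.
under eq_bigr do rewrite nth_addpart nth_scalepart.
rewrite big_split -big_distrr /= -!sumn_nth ?leq_maxl ?leq_maxr //.
by rewrite (sumn_part hla) (sumn_part hal).
Qed.

(** Both parts are expanded in powers of p; the difference in degree i is at most
    p - 1, and the sum of the (p - 1) p ^ i for i <= s is less than p ^ (s + 1). *)
Lemma p_adic_diff_lt p mu s mus n i : prime p -> p_adic_expansion p mu s mus ->
  s < n -> nth 0 mu i - nth 0 mu i.+1 < p ^ n.
Proof.
move=> hp [hmus _ ->] sn.
have nthE j : nth 0 (\big[addpart/[::]]_(i < s.+1) scalepart (p ^ i) (mus i)) j
    = \sum_(i < s.+1) p ^ i * nth 0 (mus i) j.
  rewrite (big_morph (fun l => nth 0 l j) (fun l l' =>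
    nth_addpart l l' j) (nth_nil _ j)).
  by apply: eq_bigr => l _; rewrite nth_scalepart.
rewrite !nthE; have p0 := prime_gt0 hp; have p1 := prime_gt1 hp.
apply: (@leq_trans (p ^ s.+1)); last by rewrite leq_exp2l.
elim: s.+1 => [|m IHm]; first by rewrite !big_ord0.
rewrite !big_ord_recr /=.
have [_ res] := hmus m; have := res i; set x := nth 0 _ i;
  set y := nth 0 _ i.+1 => xy.
have : p ^ m * x <= p ^ m * y + p ^ m * p.-1.
  by rewrite -mulnDr leq_mul2l; apply/orP; right; lia.
have : p ^ m * p.-1 + p ^ m = p ^ m.+1.
  by rewrite expnSr -[X in _ + X]muln1 -mulnDr addn1 prednK.
move: IHm; move: (\sum_(i0 < m) _) (\sum_(i0 < m) _) => sx sy.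
move: (p ^ m) (p ^ m.+1) (p ^ m * x) (p ^ m * y) (p ^ m * p.-1) => *; lia.
Qed.

End Partitions.

Section Uniqueness.

(** The [g x] are the remainders modulo [q] of the [f x], so they are at most
    equal to them, and the sums agree. *)
Lemma digit_unique (J : finType) (q : nat) (f f' g g' : J -> nat) :
  (forall x, f x + q * f' x = g x + q * g' x) -> (forall x, g x < q) ->
  \sum_x f x = \sum_x g x -> (forall x, f x = g x) /\ (forall x, f' x = g' x).
Proof.
move=> e gq sfg.
have le x : g x <= f x.
  have <- : f x %% q = g x; last exact: leq_mod.
  by rewrite -(modnMDl (f' x) (f x)) mulnC addnC e addnC mulnC modnMDl modn_small.
have fg x : f x = g x.
  have := leqif_sum (fun x (_ : xpredT x) => leqif_eq (le x)).
  by case=> _; rewrite sfg eqxx => /esym/forallP/(_ x)/eqP.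
split=> // x; have := e x; rewrite fg => /addnI/eqP; rewrite eqn_mul2l.
by case: (q) (gq x) => // q' _ /eqP.
Qed.

End Uniqueness.

(** * The form of a sum of shapes *)

Section Assembly.

Import GRing.Theory.
Local Open Scope ring_scope.

Variables (k : fieldType) (N b : nat).

Local Notation I := ('I_N.+1 * 'I_N.+1)%type.
Local Notation fty := {ffun I -> nat}.
Local Notation FT := {ffun I -> 'I_b.+1}.

Lemma kostka_form_young_form r la mu (A B : fty) : kostka_form k r la mu A B =
  (tcontent A == content (row_word N r la))%:R * young_form k r mu A B.
Proof.
rewrite /kostka_form /young_form mulr_sumr big_mkcond /=; apply: eq_bigr => w _.
have [e|ne] := boolP (jcount (row_word N r mu) w == A).
  by rewrite -(eqP e) tcontent_jcount; case: ifP; rewrite ?mul1r ?mul0r.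
rewrite [X in _ = _ * X]big1 ?mulr0 => [|h _]; last by rewrite mulr0.
by case: ifP => // _; rewrite big1 // => h _; rewrite mulr0.
Qed.

Lemma young_form_neq0 r mu (A B : fty) : young_form k r mu A B != 0 -> exists w h,
  jcount (row_word N r mu) w = A /\ jcount (wact (row_word N r mu) h) w = B.
Proof.
move=> nz; have [/existsP[w /existsP[h /andP[/eqP wA /eqP wB]]]|nex] :=
  boolP [exists w, exists h, (jcount (row_word N r mu) w == A) &&
                             (jcount (wact (row_word N r mu) h) w == B)].
  by exists w, h.
case/eqP: nz; rewrite /young_form big1 // => w _; rewrite big1 // => h _.
case: (boolP (_ && _)) => [wAB|]; last by rewrite mulr0.
by case/existsP: nex; exists w; apply/existsP; exists h.
Qed.

Lemma young_form_content r mu (A B : fty) : young_form k r mu A B != 0 ->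
  tcontent A = tcontent B.
Proof. by case/young_form_neq0 => w [h [<- <-]]; rewrite !tcontent_jcount. Qed.

Definition total (A : fty) : nat := (\sum_x A x)%N.

Lemma total_tcontent A : total A = (\sum_j tcontent A j)%N.
Proof.
rewrite /total (eq_bigr (fun x => A (x.1, x.2))) => [|[]] //.
rewrite -(pair_bigA _ (fun i j => A (i, j))) exchange_big /=.
by apply: eq_bigr => j _; rewrite ffunE.
Qed.

Lemma sum_cont r (w : {ffun 'I_r -> 'I_N.+1}) : (\sum_j content w j = r)%N.
Proof.
rewrite -[RHS]card_ord -sum1_card (partition_big w xpredT) //=.
by apply: eq_bigr => j _; rewrite ffunE -sum1dep_card.
Qed.

Lemma young_form_total r mu (A B : fty) : young_form k r mu A B != 0 -> total A = r.
Proof.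
case/young_form_neq0 => w [h [<- _]].
by rewrite total_tcontent tcontent_jcount sum_cont.
Qed.

Lemma young_form_sym r mu (A B : fty) :
  young_form k r mu A B = young_form k r mu B A.
Proof.
rewrite /young_form exchange_big [RHS]exchange_big /= (reindex_inj invg_inj) /=.
apply: eq_big => [h|h _]; first by rewrite groupV.
have winj : injective (fun w : {ffun 'I_r -> 'I_N.+1} => wact w h^-1%g).
  by move=> u u' e; rewrite -(wact1 u) -(wact1 u') -(mulVg h^-1%g) !wactM e.
rewrite [LHS](reindex_inj winj); apply: eq_bigr => w _.
by rewrite jcount_wact odd_permV -[jcount (row_word N r mu) (wact w
  _)]jcount_wactl andbC.
Qed.

Lemma young_form_sum r mu (F : fty -> fty -> k) : (r <= b)%N ->
  \sum_(A : FT) \sum_(B : FT) young_form k r mu (type_val A) (type_val B) *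
    F (type_val A) (type_val B) =
  \sum_w \sum_(h in column_stabiliser r mu)
     (-1) ^+ h * F (jcount (row_word N r mu) w)
                   (jcount (wact (row_word N r mu) h) w).
Proof.
move=> rb.
transitivity (\sum_w \sum_(h in column_stabiliser r mu) \sum_(A : FT) \sum_(B : FT)
   (-1) ^+ h * ((jcount (row_word N r mu) w == type_val A) &&
     (jcount (wact (row_word N r mu) h) w == type_val B))%:R *
       F (type_val A) (type_val B)).
  under [RHS]eq_bigr do rewrite exchange_big /=.
  rewrite [RHS]exchange_big /=; apply: eq_bigr => A _.
  under [RHS]eq_bigr do rewrite exchange_big /=.
  rewrite [RHS]exchange_big /=; apply: eq_bigr => B _.
  by rewrite /young_form mulr_suml; apply: eq_bigr => w _; rewrite mulr_suml.
apply: eq_bigr => w _; apply: eq_bigr => h _.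
have tyE (u v : {ffun 'I_r -> 'I_N.+1}) :
    type_val (type_of b (jcount u v)) = jcount u v :> fty.
  by rewrite type_ofK // => x; apply: jcount_le.
rewrite (bigD1 (type_of b (jcount (row_word N r mu) w))) //= [X in _ + X]big1
  => [|A nA]; last first.
  rewrite big1 // => B _; case: eqP => [wA|_]; last by rewrite mulr0 mul0r.
  by case/eqP: nA; apply: type_val_inj; rewrite tyE.
rewrite addr0 (bigD1 (type_of b (jcount (wact (row_word N r mu) h) w))) //=
  big1 => [|B nB]; last first.
  case: (jcount _ w =P type_val B) => [wB|_]; last by rewrite andbF mulr0 mul0r.
  by case/eqP: nB; apply: type_val_inj; rewrite tyE.
by rewrite addr0 !tyE !eqxx mulr1.
Qed.

Variables (p n r a : nat) (la mu al de : seq nat).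
Hypotheses (hp : prime p) (hk : p \in [pchar k]).
Hypotheses (hla : is_part_of r la) (hmu : is_part_of r mu).
Hypotheses (hal : is_part_of a al) (hde : is_part_of a de).
Local Notation q := (p ^ n)%N.
Hypotheses (sN : (r + q * a <= N)%N) (sb : (r + q * a <= b)%N).
Local Notation ka := (addpart la (scalepart q al)).
Local Notation nu := (addpart mu (scalepart q de)).

Let q_gt0 : (0 < q)%N. Proof. by rewrite expn_gt0 prime_gt0. Qed.
Let hka : is_part_of (r + q * a) ka. Proof. exact: add_scale_part. Qed.
Let hnu : is_part_of (r + q * a) nu. Proof. exact: add_scale_part. Qed.
Let a_le : (a <= r + q * a)%N.
Proof. by rewrite (leq_trans (leq_pmull a q_gt0)) ?leq_addl. Qed.
Let rN : (r <= N)%N. Proof. exact: leq_trans (leq_addr _ _) sN. Qed.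
Let rb : (r <= b)%N. Proof. exact: leq_trans (leq_addr _ _) sb. Qed.
Let aN : (a <= N)%N. Proof. exact: leq_trans a_le sN. Qed.
Let ab : (a <= b)%N. Proof. exact: leq_trans a_le sb. Qed.

Local Notation g1 := (fun A B : FT => young_form k r mu (type_val A) (type_val B)).
Local Notation g2 := (fun A B : FT => young_form k a de (type_val A) (type_val B)).
Local Notation m1 := (fun A B : FT =>
  kostka_form k r la mu (type_val A) (type_val B)).
Local Notation m2 := (fun A B : FT =>
  kostka_form k a al de (type_val A) (type_val B)).
Local Notation m3 := (fun A B : FT =>
  kostka_form k (r + q * a) ka nu (type_val A) (type_val B)).
Definition pair_type (x : FT * FT) : fty :=
  add_types q (type_val x.1) (type_val x.2).

Lemma young_form_conv_pairs (A B : fty) : young_form k (r + q * a) nu A B =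
  \sum_(x : FT * FT) \sum_(y : FT * FT)
   (pair_type x == A)%:R * (g1 x.1 y.1 * g2 x.2 y.2) * (pair_type y == B)%:R.
Proof.
have nuE i : (nth 0 nu i = nth 0 mu i + q * nth 0 de i)%N.
  by rewrite nth_addpart nth_scalepart.
rewrite (young_form_conv hp hk A B hmu hde hnu rN aN sN nuE).
pose F2 X Y := \sum_(x2 : FT) \sum_(y2 : FT) g2 x2 y2 *
   ((add_types q X (type_val x2) == A) && (add_types q Y (type_val y2) == B))%:R.
transitivity (\sum_(x1 : FT) \sum_(y1 : FT) g1 x1 y1 *
  F2 (type_val x1) (type_val y1)).
  rewrite (young_form_sum _ F2) //; apply: eq_bigr => w _; apply: eq_bigr => h _.
  rewrite /F2 (young_form_sum _ (fun X Y =>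
    ((add_types q _ X == A) && (add_types q _ Y == B))%:R)) //.
  rewrite mulr_sumr; apply: eq_bigr => w' _; rewrite mulr_sumr.
  by apply: eq_bigr => h' _; rewrite mulrA.
rewrite -(pair_bigA _ (fun x1 x2 =>
  \sum_(y : FT * FT) (pair_type (x1, x2) == A)%:R *
  (g1 x1 y.1 * g2 x2 y.2) * (pair_type y == B)%:R)) /=.
apply: eq_bigr => x1 _; rewrite exchange_big /=.
rewrite -(pair_bigA _ (fun y1 y2 => \sum_x2 (pair_type (x1, x2) == A)%:R *
  (g1 x1 y1 * g2 x2 y2) * (pair_type (y1, y2) == B)%:R)) /=.
apply: eq_bigr => y1 _; rewrite /F2 exchange_big mulr_sumr /=.
apply: eq_bigr => y2 _; rewrite mulr_sumr; apply: eq_bigr => x2 _.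
rewrite -mulnb natrM [RHS]mulrAC [RHS]mulrC -!mulrA; congr (_ * _).
Qed.

Lemma content_row_word j r' nu' : is_part_of r' nu' -> (r' <= N)%N ->
  content (row_word N r' nu') j = nth 0%N nu' j.
Proof.
move=> hnu' r'N; rewrite ffunE -(card_crow hnu'); apply: eq_card => c.
by rewrite !inE -(row_wordE hnu' r'N).
Qed.

Lemma tcontent_pair_type x j : tcontent (pair_type x) j =
  (tcontent (type_val x.1) j + q * tcontent (type_val x.2) j)%N.
Proof.
rewrite !ffunE big_distrr -big_split /=; apply: eq_bigr => i _.
by rewrite [pair_type x _]ffunE.
Qed.

Lemma content_sum_part j : content (row_word N (r + q * a) ka) j =
  (content (row_word N r la) j + q * content (row_word N a al) j)%N.
Proof. by rewrite !content_row_word // nth_addpart nth_scalepart. Qed.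

(** The pairs of types of the contents that enter in the theorem. *)
Definition good_pair (x : FT * FT) : bool :=
  (tcontent (type_val x.1) == content (row_word N r la)) &&
    (tcontent (type_val x.2) == content (row_word N a al)).

Lemma good_pair_content x : good_pair x ->
  tcontent (pair_type x) = content (row_word N (r + q * a) ka).
Proof.
case/andP => /eqP e1 /eqP e2; apply/ffunP => j.
by rewrite tcontent_pair_type e1 e2 content_sum_part.
Qed.

Lemma pair_formE x y : m1 x.1 y.1 * m2 x.2 y.2 =
  (good_pair x)%:R * (g1 x.1 y.1 * g2 x.2 y.2).
Proof. by rewrite /= !kostka_form_young_form mulrACA -natrM mulnb. Qed.

Lemma pair_form_neq0 x y : m1 x.1 y.1 * m2 x.2 y.2 != 0 ->
  good_pair x /\ good_pair y.
Proof.
rewrite pair_formE; case gx : (good_pair x); last by rewrite mul0r eqxx.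
rewrite mul1r mulf_eq0 negb_or =>
  /andP[/young_form_content e1 /young_form_content e2].
by split=> //; move: gx; rewrite /good_pair e1 e2.
Qed.

Definition truncated (A : FT) : bool := [forall x, type_val A x < q]%N.
Definition truncated_form (A B : FT) : k :=
  (truncated A && truncated B)%:R * m1 A B.

Lemma pair_type_inj x y : truncated y.1 ->
  total (type_val x.1) = total (type_val y.1) ->
  pair_type x = pair_type y -> x = y.
Proof.
move=> /forallP ty txy /ffunP e.
have [e1 e2] : (forall z, type_val x.1 z = type_val y.1 z) /\
    (forall z, type_val x.2 z = type_val y.2 z).
  by apply: (@digit_unique _ q) => // z; have := e z; rewrite !ffunE.
case: x y {ty txy e} e1 e2 =>
  x1 x2 [y1 y2] /= /ffunP/type_val_inj-> /ffunP/type_val_inj->.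
by [].
Qed.

Lemma pair_type_le x : good_pair x -> forall z, (pair_type x z <= b)%N.
Proof.
case/andP => /eqP e1 /eqP e2 z; apply: leq_trans sb; rewrite ffunE.
have le (A : fty) y : (A y <= total A)%N by rewrite /total (bigD1 y) //= leq_addr.
have tot1 : total (type_val x.1) = r by rewrite total_tcontent e1 sum_cont.
have tot2 : total (type_val x.2) = a by rewrite total_tcontent e2 sum_cont.
by apply: leq_add; [rewrite -tot1 | rewrite -tot2 leq_mul2l]; rewrite le ?orbT.
Qed.

Lemma young_form_good x y : good_pair x -> good_pair y -> truncated x.1 ->
  truncated y.1 ->
  young_form k (r + q * a) nu (pair_type x) (pair_type y) = g1 x.1 y.1 * g2 x.2 y.2.
Proof.
move=> gx gy tx ty; rewrite young_form_conv_pairs.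
have tot z : good_pair z -> total (type_val z.1) = r.
  by case/andP => /eqP e1 _; rewrite total_tcontent e1 sum_cont.
rewrite (bigD1 x) //= [X in _ + X]big1 ?addr0 => [|x' nx]; last first.
  rewrite big1 // => y' _; case: eqP => [e|_]; last by rewrite !mul0r.
  have [->|nz] := eqVneq (g1 x'.1 y'.1) 0; first by rewrite mul0r mulr0 mul0r.
  by case/eqP: nx; apply: pair_type_inj => //; rewrite tot // (young_form_total nz).
rewrite (bigD1 y) //= !eqxx mul1r mulr1 big1 ?addr0 // => y' ny.
case: eqP => [e|_]; last by rewrite mulr0.
rewrite mulr1 mul1r; have [->|nz] := eqVneq (g1 x.1 y'.1) 0; first by rewrite mul0r.
case/eqP: ny; apply: pair_type_inj => //; rewrite tot //.
by move: nz; rewrite young_form_sym => /young_form_total.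
Qed.

(** On truncated types of the right contents, the form of the sum is the
    Kronecker product; the matrix [S] selects these types. *)
Lemma form_rank_truncated_tensor : (form_rank truncated_form *
  form_rank m2 <= form_rank m3)%N.
Proof.
rewrite -form_rank_tensor.
pose S (x : FT * FT) (A : FT) : k :=
  (good_pair x && truncated x.1 && (type_of b (pair_type x) == A))%:R.
apply: (@form_rank_mul k _ _ _ _ S (fun A x => S x A)) => x y.
rewrite /truncated_form -mulrA.
have sumS (z : FT * FT) (F : FT -> k) : \sum_A S z A * F A =
    (good_pair z && truncated z.1)%:R * F (type_of b (pair_type z)).
  rewrite (bigD1 (type_of b (pair_type z))) //= /S eqxx andbT big1 ?addr0 // =>
    A nA.
  by rewrite [_ == A]eq_sym (negPf nA) andbF mul0r.
transitivity (\sum_A S x A * (\sum_B S y B * m3 A B)); last first.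
  apply: eq_bigr => A _; rewrite mulr_sumr; apply: eq_bigr => B _.
  by rewrite -mulrA; congr (_ * _); rewrite mulrC.
rewrite (sumS x (fun A => \sum_B S y B * m3 A B)) (sumS y (m3 _)).
have [tx|_] := boolP (truncated x.1); last by rewrite andbF !mul0r.
have [ty|_] := boolP (truncated y.1); last by rewrite !andbF !mul0r mulr0.
have [m0|/pair_form_neq0[gx gy]] := eqVneq (m1 x.1 y.1 * m2 x.2 y.2) 0; last first.
  rewrite gx gy !mul1r pair_formE gx mul1r kostka_form_young_form !type_ofK;
    try exact: pair_type_le.
  by rewrite good_pair_content // eqxx mul1r young_form_good.
rewrite m0 mulr0; case gx : (good_pair x); last by rewrite mul0r.
case gy : (good_pair y); last by rewrite mul0r mulr0.
rewrite !mul1r kostka_form_young_form !type_ofK; try exact: pair_type_le.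
by rewrite young_form_good // good_pair_content // eqxx mul1r; move: m0;
  rewrite pair_formE gx mul1r.
Qed.

Hypothesis muq : forall i, (nth 0 mu i - nth 0 mu i.+1 < q)%N.

(** By the symmetry of the form, rows and columns can be truncated in turn. *)
Lemma form_rank_truncated : (form_rank m1 <= form_rank truncated_form)%N.
Proof.
have [c [cE c0]] := young_form_truncation hmu rN hp hk rb muq.
have cm E B : m1 E B = \sum_A c E A * m1 A B.
  rewrite kostka_form_young_form cE mulr_sumr; apply: eq_bigr => A _;
    rewrite kostka_form_young_form.
  have [->|/c0[_ ->]] := eqVneq (c E A) 0; first by rewrite !mul0r mulr0.
  by rewrite mulrCA.
have m1_sym A B : m1 A B = m1 B A.
  rewrite !kostka_form_young_form young_form_sym;
    have [->|/young_form_content ->//] :=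
    eqVneq (young_form k r mu (type_val B) (type_val A)) 0.
  by rewrite !mulr0.
apply: (@form_rank_mul k _ _ _ _ c (fun B E => c E B)) => E B.
rewrite cm; apply: eq_bigr => A _; rewrite m1_sym cm mulr_sumr;
  apply: eq_bigr => B' _.
rewrite /truncated_form m1_sym.
have [->|/c0[tA _]] := eqVneq (c E A) 0; first by rewrite !mul0r.
have [->|/c0[tB _]] := eqVneq (c B B') 0; first by rewrite !mul0r !mulr0.
have -> : truncated A by apply/forallP.
have -> : truncated B' by apply/forallP.
by rewrite mul1r mulrAC mulrA.
Qed.

Lemma form_rank_lower : (form_rank m1 * form_rank m2 <= form_rank m3)%N.
Proof. by apply: leq_trans form_rank_truncated_tensor;
  rewrite leq_mul2r form_rank_truncated orbT. Qed.

(** The content [la + q al] decomposes only as given, because the parts of [la]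
    are remainders modulo [q]. *)
Lemma form_rank_upper : (nth 0 la 0 < q)%N ->
  (form_rank m3 <= form_rank m1 * form_rank m2)%N.
Proof.
move=> la0; rewrite -form_rank_tensor.
apply: (@form_rank_mul k _ _ _ _ (fun A x =>
  (pair_type x == type_val A)%:R) (fun y B =>
  (pair_type y == type_val B)%:R)) => A B.
rewrite kostka_form_young_form young_form_conv_pairs mulr_sumr;
  apply: eq_bigr => x _.
rewrite mulr_sumr; apply: eq_bigr => y _.
rewrite mulrA; congr (_ * _); rewrite mulrCA pair_formE.
case: eqP => [xA|_]; last by rewrite !mul0r.
rewrite !mul1r -xA.
have [->|nz] := eqVneq (g1 x.1 y.1) 0; first by rewrite mul0r !mulr0.
congr ((nat_of_bool _)%:R * _); apply/eqP/idP => [e|];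
  last exact: good_pair_content.
have [|||e1 e2] := @digit_unique _ q (tcontent (type_val x.1)) (tcontent
  (type_val x.2))
   (content (row_word N r la)) (content (row_word N a al)).
- by move=> j; rewrite -tcontent_pair_type e content_sum_part.
- move=> j; rewrite content_row_word //; apply: leq_ltn_trans la0.
  exact: (part_noninc hla).
- by rewrite -total_tcontent (young_form_total nz) sum_cont.
by rewrite /good_pair; apply/andP; split; apply/eqP/ffunP.
Qed.

End Assembly.

Theorem theorem13 (p : nat) (k : fieldType) (hp : prime p)
  (hk : p \in [pchar k]%R)
  (a r : nat) (ha : 0 < a) (hr : 0 < r)
  (la mu : seq nat) (hla : is_part_of r la) (hmu : is_part_of r mu)
  (al de : seq nat) (hal : is_part_of a al) (hde : is_part_of a de)
  (s : nat) (mus : nat -> seq nat) (hmus : p_adic_expansion p mu s mus)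
  (n : nat) (hn : s < n) :
  (p_kostka k r la mu * p_kostka k a al de <=
     p_kostka k (r + p ^ n * a) (addpart la (scalepart (p ^ n) al))
                                (addpart mu (scalepart (p ^ n) de)))
  /\
  (nth 0 la 0 < p ^ n ->
   p_kostka k (r + p ^ n * a) (addpart la (scalepart (p ^ n) al))
                              (addpart mu (scalepart (p ^ n) de))
   = p_kostka k r la mu * p_kostka k a al de).
Proof.
(* [N] bounds the number of rows of each shape and every entry of a type. *)
pose N := r + p ^ n * a.
have q0 : 0 < p ^ n by rewrite expn_gt0 prime_gt0.
have rN : r <= N by apply: leq_addr.
have aN : a <= N by rewrite (leq_trans (leq_pmull a q0)) ?leq_addl.
have muq i : nth 0 mu i - nth 0 mu i.+1 < p ^ n.
  exact: p_adic_diff_lt hmus hn.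
rewrite !(@p_kostka_form_rank k N N) ?add_scale_part //.
have low := form_rank_lower hp hk hla hmu hal hde (leqnn N) (leqnn N) muq.
split=> // la0; apply/eqP; rewrite eqn_leq low andbT.
exact: form_rank_upper.
Qed.
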